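(* Any instance of the PP-problem with $n$ jobs, processing times $a_j,b_j$ ($j\in N$) and storage capacity $\Omega$ that satisfies $$\Omega\ge 4.5\,\max\{a_{max},b_{max}\},$$ where $a_{max}=\max_{i\in N}a_i$ and $b_{max}=\max_{i\in N}b_i$, can be solved (i.e. an optimal schedule can be found) in $O(n\log n)$ time.
   Context: PP-problem. An instance consists of a set of jobs $N=\{1,\dots,n\}$, nonnegative processing times $a_j$ and $b_j$ for each $j\in N$, and a storage capacity $\Omega$. Each job $j$ must be processed without interruption on the first-stage machine $M_1$ for $a_j$ time units and, after that, without interruption on the second-stage machine $M_2$ for $b_j$ time units. A schedule $\sigma$ specifies start times $S_j^1(\sigma)\ge 0$ and $S_j^2(\sigma)\ge 0$ on $M_1$ and $M_2$; the completion times are $C_j^1(\sigma)=S_j^1(\sigma)+a_j$ and $C_j^2(\sigma)=S_j^2(\sigma)+b_j$. The schedule is feasible if: (i) each machine processes at most one job at a time (for distinct jobs $i,j$ and each machine $M_k$, either $C_i^k(\sigma)\le S_j^k(\sigma)$ or $C_j^k(\sigma)\le S_i^k(\sigma)$); (ii) $S_j^2(\sigma)\ge C_j^1(\sigma)$ for every job $j$; (iii) each job $j$ occupies $a_j$ units of storage from $S_j^1(\sigma)$ until $C_j^2(\sigma)$, and at any time $t$ the total storage occupied, $\sum_{j:\,S_j^1(\sigma)\le t<C_j^2(\sigma)}a_j$, does not exceed $\Omega$. The goal is to find a feasible schedule minimising the makespan $C_{\max}(\sigma)=\max_{j\in N}C_j^2(\sigma)$. Running time is counted in elementary operations (arithmetic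 operations, rounding and comparisons on numbers have unit cost). *)

(* Defs.v *)
From mathcomp Require Import all_boot all_order all_algebra.
From mathcomp Require Import all_classical all_reals all_analysis.

Set Implicit Arguments.
Unset Strict Implicit.
Unset Printing Implicit Defensive.

Import Order.TTheory GRing.Theory Num.Theory.
Import numFieldNormedType.Exports.

Local Open Scope ring_scope.

(** * The two-machine problem with storage *)

(* Jobs are the elements of 'I_n. *)
Record instance (R : realType) (n : nat) := Instance {
  proc1 : 'I_n -> R;
  proc2 : 'I_n -> R;
  capacity : R;
  proc1_ge0 : forall j, 0 <= proc1 j;
  proc2_ge0 : forall j, 0 <= proc2 j
}.

Record schedule (R : realType) (n : nat) := Schedule {
  start1 : 'I_n -> R;
  start2 : 'I_n -> R
}.

Section Problem.
Variables (R : realType) (n : nat) (I : instance R n).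
Implicit Type s : schedule R n.

Definition compl1 s (j : 'I_n) : R := start1 s j + proc1 I j.
Definition compl2 s (j : 'I_n) : R := start2 s j + proc2 I j.

(* The total size of the jobs stored at time t; the occupation intervals are
   closed on the left and open on the right. *)
Definition storage s (t : R) : R :=
  \sum_(j < n | (start1 s j <= t) && (t < compl2 s j)) proc1 I j.

Record feasible s : Prop := Feasible {
  start1_ge0 : forall j, 0 <= start1 s j;
  start2_ge0 : forall j, 0 <= start2 s j;
  machine1 : forall i j, i != j ->
    compl1 s i <= start1 s j \/ compl1 s j <= start1 s i;
  machine2 : forall i j, i != j ->
    compl2 s i <= start2 s j \/ compl2 s j <= start2 s i;
  stage_order : forall j, compl1 s j <= start2 s j;
  storage_le : forall t, storage s t <= capacity I
}.

(* The default value 0 of the maxima below only matters for n = 0: processing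
   times, and completion times of feasible schedules, are nonnegative. *)
Definition makespan s : R := \big[Num.max/0]_(j < n) compl2 s j.
Definition proc1_max : R := \big[Num.max/0]_(j < n) proc1 I j.
Definition proc2_max : R := \big[Num.max/0]_(j < n) proc2 I j.

Definition optimal s : Prop :=
  feasible s /\ forall s', feasible s' -> makespan s <= makespan s'.

End Problem.

(** * A unit-cost random access machine over the reals *)

(* Programs are finite texts, independent of the input and of its size, over
   finitely many unbounded arrays of numbers; a scalar variable is a fixed cell
   of an array. The only literals are integers. *)
Inductive expr :=
| Const of int
| Read of nat & expr          (* Read k e is the cell of index e of array k *)
| Add of expr & expr
| Sub of expr & expr
| Mul of expr & expr
| Div of expr & expr
| Floor of expr.

Inductive test :=
| Le of expr & expr
| Lt of expr & expr
| Not of test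
| And of test & test.

Inductive program :=
| Skip
| Write of nat & expr & expr  (* Write k e1 e2 stores e2 at index e1 of array k *)
| Seq of program & program
| If of test & program & program
| While of test & program.

(* mem k i is the content of the cell of index i of array k. *)
Definition memory (R : realType) := nat -> nat -> R.

Definition update (R : realType) (mem : memory R) (k i : nat) (x : R) :
    memory R :=
  fun k' i' => if (k' == k) && (i' == i) then x else mem k' i'.

(* Indices are rounded down by Num.truncn, which sends negative numbers to 0;
   division by 0 returns 0. *)
Fixpoint eval (R : realType) (mem : memory R) (e : expr) : R :=
  match e with
  | Const z => z%:~R
  | Read k e1 => mem k (Num.truncn (eval mem e1))
  | Add e1 e2 => eval mem e1 + eval mem e2
  | Sub e1 e2 => eval mem e1 - eval mem e2
  | Mul e1 e2 => eval mem e1 * eval mem e2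
  | Div e1 e2 => eval mem e1 / eval mem e2
  | Floor e1 => (Num.floor (eval mem e1))%:~R
  end.

Fixpoint eval_test (R : realType) (mem : memory R) (b : test) : bool :=
  match b with
  | Le e1 e2 => eval mem e1 <= eval mem e2
  | Lt e1 e2 => eval mem e1 < eval mem e2
  | Not b1 => ~~ eval_test mem b1
  | And b1 b2 => eval_test mem b1 && eval_test mem b2
  end.

(* Each operation, literal and memory access costs one unit. *)
Fixpoint cost (e : expr) : nat :=
  match e with
  | Const _ => 1%N
  | Read _ e1 | Floor e1 => (cost e1).+1%N
  | Add e1 e2 | Sub e1 e2 | Mul e1 e2 | Div e1 e2 => (cost e1 + cost e2).+1%N
  end.

Fixpoint cost_test (b : test) : nat :=
  match b with
  | Le e1 e2 | Lt e1 e2 => (cost e1 + cost e2).+1%N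
  | Not b1 => (cost_test b1).+1%N
  | And b1 b2 => (cost_test b1 + cost_test b2).+1%N
  end.

(* exec p mem t mem' : started in mem, the program p halts in mem' after t
   elementary operations. *)
Inductive exec (R : realType) :
    program -> memory R -> nat -> memory R -> Prop :=
| ExecSkip mem : exec Skip mem 1 mem
| ExecWrite mem k e1 e2 :
    exec (Write k e1 e2) mem (cost e1 + cost e2).+1
      (update mem k (Num.truncn (eval mem e1)) (eval mem e2))
| ExecSeq p1 p2 mem t1 mem1 t2 mem2 :
    exec p1 mem t1 mem1 -> exec p2 mem1 t2 mem2 ->
    exec (Seq p1 p2) mem (t1 + t2) mem2
| ExecIf b p1 p2 mem t mem' :
    exec (if eval_test mem b then p1 else p2) mem t mem' ->
    exec (If b p1 p2) mem (cost_test b + t) mem'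
| ExecWhileDone b p mem :
    ~~ eval_test mem b -> exec (While b p) mem (cost_test b) mem
| ExecWhileStep b p mem t1 mem1 t2 mem2 :
    eval_test mem b -> exec p mem t1 mem1 -> exec (While b p) mem1 t2 mem2 ->
    exec (While b p) mem (cost_test b + t1 + t2) mem2.

(* Input: array 0 starts with n and the capacity, arrays 1 and 2 contain the
   processing times; all other cells contain 0. *)
Definition input (R : realType) (n : nat) (I : instance R n) : memory R :=
  fun k i =>
    match k, i with
    | 0%N, 0%N => n%:R
    | 0%N, 1%N => capacity I
    | 1%N, _ => oapp (proc1 I) 0 (insub i)
    | 2%N, _ => oapp (proc2 I) 0 (insub i)
    | _, _ => 0
    end.

(* Output: the start times are read from arrays 3 and 4. *)
Definition output (R : realType) (n : nat) (mem : memory R) : schedule R n :=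
  Schedule (fun j : 'I_n => mem 3%N j) (fun j : 'I_n => mem 4%N j).

(* Main.v *)
(* Put P = capacity / 4, which bounds every processing time. If every job leaves
   the storage at most 3P after it enters, then the storage constraint holds:
   the jobs stored at time t are processed on the first machine, one after the
   other, between t - 3P and t + P. It remains to reach the makespan of
   Johnson's rule, optimal without storage, under this constraint. Reversing
   time exchanges the two machines, so assume that the first machine has the
   smaller total load. Start the second machine at Johnson's head start and
   never let it wait. Johnson's order has two halves, a <= b sorted by
   increasing a, then b < a sorted by decreasing b; merge them, taking the next
   job of the first half only while the head start s is less than P + (head
   start needed by the rest of the first half). This keeps s <= 2P as long as
   the second half is not exhausted; afterwards the first machine waits
   whenever s exceeds 2P. Johnson's order is found by repeated extraction from a
   tournament tree. *)

Require Import Defs.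
From mathcomp Require Import all_boot all_order all_algebra.
From mathcomp Require Import all_classical all_reals all_analysis.
From mathcomp Require Import ring lra zify.
Import Order.TTheory GRing.Theory Num.Theory.
Import numFieldNormedType.Exports.
Import Defs.
Local Open Scope classical_set_scope.
Local Open Scope ring_scope.

Set Implicit Arguments.
Unset Strict Implicit.

(** * Flow shops and Johnson's order *)

Section FlowShop.
Variables (R : realFieldType) (J : eqType).
Implicit Types (a b S : J -> R) (l : seq J).

Lemma ler_sum_in l (f g : J -> R) :
  {in l, forall x, f x <= g x} -> \sum_(x <- l) f x <= \sum_(x <- l) g x.
Proof. by move=> fg; rewrite big_seq [leRHS]big_seq; apply: ler_sum. Qed.

Definition disjoint l (p : J -> R) S := {in l &, forall x y, x != y ->
  S x + p x <= S y \/ S y + p y <= S x}.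

Lemma sub_disjoint l l' (p : J -> R) S :
  {subset l' <= l} -> disjoint l p S -> disjoint l' p S.
Proof. by move=> sl dl x y xl yl; apply: dl; apply: sl. Qed.

(** A job [z] splits the others into those that end before it starts and those that start after it
    ends. By induction each group fits into the part of the interval on its side of [z]. *)
Lemma packing l (p : J -> R) S (u v : R) :
  uniq l -> u <= v -> disjoint l p S ->
  {in l, forall x, u <= S x /\ S x + p x <= v} ->
  \sum_(x <- l) p x <= v - u.
Proof.
have [k] := ubnP (size l); elim: k l u v => // k IH [|z l] u v /= sl.
  by rewrite big_nil subr_ge0.
move=> /andP[zl ul] uv dl bl; rewrite big_cons.
have [uz zv] := bl z (mem_head _ _).
have sub (A : pred J) : {subset seq.filter A l <= z :: l}.
  by move=> x; rewrite mem_filter inE => /andP[_ ->]; rewrite orbT.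
have szf (A : pred J) : (size (seq.filter A l) < k)%N.
  by rewrite size_filter (leq_ltn_trans (count_size _ _)).
pose A := [pred x | S x + p x <= S z].
have left_le : \sum_(x <- seq.filter A l) p x <= S z - u.
  apply: IH => //; first exact: filter_uniq.
    exact: (sub_disjoint (sub _) dl).
  move=> x xf; have [ux _] := bl x (sub _ x xf).
  by move: xf; rewrite mem_filter => /andP[].
have right_le : \sum_(x <- seq.filter (predC A) l) p x <= v - (S z + p z).
  apply: IH => //; first exact: filter_uniq.
    exact: (sub_disjoint (sub _) dl).
  move=> x xf; have xl := sub _ x xf; have [_ xv] := bl x xl.
  move: xf; rewrite mem_filter /= => /andP[nA xl']; split=> //.
  have nxz : x != z by apply: contraNneq zl => <-.
  by have [h|] := dl x z xl (mem_head _ _) nxz; first by rewrite h in nA.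
rewrite -(perm_big _ (permEl (perm_filterC A l))) big_cat /=.
apply: le_trans (lerD (lexx _) (lerD left_le right_le)) _; lra.
Qed.

(** The storage-free part of the problem. The processing times are parameters, so that the machines
    can be exchanged. *)
Record flow_shop l a b (S1 S2 : J -> R) : Prop := FlowShop {
  fs_ge0 : {in l, forall x, 0 <= S1 x};
  fs_stage : {in l, forall x, S1 x + a x <= S2 x};
  fs_disj1 : disjoint l a S1;
  fs_disj2 : disjoint l b S2 }.

Lemma sub_flow_shop l l' a b (S1 S2 : J -> R) :
  {subset l' <= l} -> flow_shop l a b S1 S2 -> flow_shop l' a b S1 S2.
Proof.
move=> sl [s0 st d1 d2].
split; [|move=> x /sl|exact: sub_disjoint d1|exact: sub_disjoint d2].
  by move=> x /sl /s0.
exact: st.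
Qed.

(** Reflecting time at [T] turns completion times into start times and the second stage into the
    first. *)
Lemma reverse_flow_shop l a b (S1 S2 : J -> R) (T : R) :
  flow_shop l a b S1 S2 -> {in l, forall x, S2 x + b x <= T} ->
  flow_shop l b a (fun x => T - S2 x - b x) (fun x => T - S1 x - a x).
Proof.
case=> g0 st d1 d2 le_T.
split=> [x /le_T|x /st|x y xl yl /(d2 _ _ xl yl)|x y xl yl /(d1 _ _ xl yl)].
- by lra.
- by lra.
- by move=> []; [right|left]; lra.
- by move=> []; [right|left]; lra.
Qed.

Lemma flow_time_storage l a b (S1 S2 : J -> R) (P t : R) : uniq l ->
  flow_shop l a b S1 S2 ->
  {in l, forall x, [/\ 0 <= a x, a x <= P & S2 x + b x <= S1 x + 3 * P]} ->
  0 <= P ->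
  \sum_(x <- l | (S1 x <= t) && (t < S2 x + b x)) a x <= 4 * P.
Proof.
move=> ul [_ _ d1 _] flow P0; rewrite -big_filter.
apply: (@le_trans _ _ ((t + P) - (t - 3 * P))); last by lra.
apply: (packing (S := S1)); rewrite ?filter_uniq //; first by lra.
  by apply: sub_disjoint d1 => x; rewrite mem_filter => /andP[].
move=> x; rewrite mem_filter => /andP[/andP[h1 h2] /flow[*]].
by split; lra.
Qed.

(** * Optimality of Johnson's order without storage *)

Section Johnson.
Variables (a b : J -> R).

(* The least head start of the first machine for which the second machine,
   processing the jobs in the order of l, never has to wait. *)
Fixpoint lead l : R :=
  if l is x :: l' then Num.max (a x) (lead l' - (b x - a x)) else 0.

(** Unfolded, [lead l] plus the total of [b] is the maximum of the critical path lengths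
    (first-machine times up to some job, second-machine times from that job on) and of the total of
    [a], which stems from the value 0 of [lead] on the empty list. The prefix [p] serves the
    induction. *)
Lemma lead_le_sum p l (T : R) :
  (forall q x r, l = q ++ x :: r ->
     \sum_(y <- p ++ q) a y + a x + b x + \sum_(y <- r) b y <= T) ->
  \sum_(y <- p ++ l) a y <= T ->
  lead l + \sum_(y <- p) a y + \sum_(y <- l) b y <= T.
Proof.
elim: l p => [|x l IH] p split_le sum_le.
  by move: sum_le; rewrite cats0 big_nil /=; lra.
have := IH (rcons p x); rewrite big_rcons big_cons /= cat_rcons => IHp.
have {}IHp : lead l + (\sum_(y <- p) a y + a x) + \sum_(y <- l) b y <= T.
  apply: IHp => // q y r lE; rewrite cat_rcons; apply: (split_le (x :: q)).
  by rewrite lE.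
have := split_le [::] x l erefl; rewrite cats0.
rewrite -!lerBrDr ge_max => h1; apply/andP; split; move: h1 IHp; lra.
Qed.

(** The jobs of [W] fill the first machine before [u] starts there, and the others fill the second
    machine after [u] has left the first. [packing] applies on both sides of the interval of [u]. *)
Lemma bottleneck l (S1 S2 : J -> R) (T : R) (u : J) (W : pred J) :
  uniq l -> u \in l -> {in l, forall x, 0 <= b x} ->
  flow_shop l a b S1 S2 -> {in l, forall x, S2 x + b x <= T} ->
  {in l, forall x, W x -> S1 x + a x <= S1 u} ->
  {in l, forall x, ~~ W x -> S1 u + a u <= S1 x + a x} ->
  a u + \sum_(x <- l) (if W x then a x else b x) <= T.
Proof.
move=> ul lu b0 [S10 st d1 d2] le_T before after.
rewrite (bigID W) /= (eq_bigr a); last by move=> x ->.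
rewrite [X in _ + (_ + X) <= _](eq_bigr b); last by move=> x /negPf ->.
rewrite -big_filter -(big_filter l (fun x => ~~ W x)).
have sub (A : pred J) : {subset seq.filter A l <= l}.
  by move=> x; rewrite mem_filter => /andP[].
have hW : \sum_(x <- seq.filter W l) a x <= S1 u - 0.
  apply: (packing (S := S1)); rewrite ?filter_uniq ?S10 //.
    exact: (sub_disjoint (sub _) d1).
  by move=> x; rewrite mem_filter => /andP[Wx lx]; rewrite S10 ?before.
have hV : \sum_(x <- [seq x <- l | ~~ W x]) b x <= T - (S1 u + a u).
  apply: (packing (S := S2)); rewrite ?filter_uniq //.
  - by have := st u lu; have := le_T u lu; have := b0 u lu; lra.
  - exact: (sub_disjoint (sub _) d2).
  move=> x; rewrite mem_filter => /andP[Wx lx]; rewrite le_T //; split=> //.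
  by apply: le_trans (st x lx); apply: after.
apply: le_trans (lerD (lexx _) (lerD hW hV)) _; lra.
Qed.

Lemma seq_argmin (f : J -> R) x l :
  exists2 u, u \in x :: l & {in x :: l, forall y, f u <= f y}.
Proof.
elim: l x => [|y l IH] x.
  by exists x; rewrite ?mem_head // => y; rewrite inE => /eqP ->.
have [u ul umin] := IH y; have [fxu|fux] := leP (f x) (f u).
  exists x; first exact: mem_head.
  by move=> z /predU1P[-> //|/umin]; apply: le_trans.
exists u; first by rewrite inE ul orbT.
by move=> z /predU1P[->|/umin //]; apply: ltW.
Qed.

(* When c bounds the processing times, the first case gives keys at most c and
   the second one keys at least c + 1. *)
Definition johnson_key (c : R) x :=
  if a x <= b x then a x else 2 * c + 1 - b x.

Definition johnson c l :=
  pairwise (fun x y => johnson_key c x <= johnson_key c y) l.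

Section Bounded.
Variables (c : R) (l : seq J).
Hypothesis ab_bound :
  {in l, forall x, [/\ 0 <= a x, a x <= c, 0 <= b x & b x <= c]}.

Lemma johnson_key_le1 x y : x \in l -> y \in l -> a x <= b x ->
  johnson_key c y <= johnson_key c x -> a y <= b y /\ a y <= a x.
Proof.
move=> /ab_bound[? ? ? ?] /ab_bound[? ? ? ?] abx.
by rewrite /johnson_key abx; case: ifP => //; lra.
Qed.

Lemma johnson_key_le2 x y : x \in l -> y \in l -> b x < a x ->
  johnson_key c x <= johnson_key c y -> b y < a y /\ b y <= b x.
Proof.
move=> /ab_bound[? ? ? ?] /ab_bound[? ? ? ?] bax.
by rewrite /johnson_key ifN -?ltNge //; case: leP => //; lra.
Qed.

Lemma johnson_split : johnson c l ->
  l = [seq x <- l | a x <= b x] ++ [seq x <- l | b x < a x].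
Proof.
suff split s : {subset s <= l} -> johnson c s ->
    s = [seq x <- s | a x <= b x] ++ [seq x <- s | b x < a x] by exact: split.
elim: s => //= x s IH sl /andP[/allP xs js].
have sl' : {subset s <= l} by move=> y ys; apply: sl; rewrite inE ys orbT.
have lx : x \in l by apply: sl; exact: mem_head.
case: leP => [_|bax] /=; first by rewrite -IH.
have s2 : all (fun y => b y < a y) s.
  apply/allP => y ys.
  by have [] := johnson_key_le2 lx (sl' y ys) bax (xs y ys).
rewrite (all_filterP s2) (@eq_in_filter _ _ pred0) ?filter_pred0 // => y ys.
by rewrite leNgt (allP s2).
Qed.

(** Each critical path of Johnson's order, turning at a job [x], is dominated term by term by a
    [bottleneck] sum of the given schedule. If [a x <= b x], the bottleneck [u] is the job that
    finishes first on machine 1 among the jobs of the first half from [x] on; otherwise it is the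
    one that finishes last among the jobs of the second half up to [x]. *)
Lemma johnson_lower_bound (S1 S2 : J -> R) (T : R) :
  uniq l -> johnson c l -> flow_shop l a b S1 S2 ->
  {in l, forall x, S2 x + b x <= T} -> 0 <= T ->
  lead l + \sum_(x <- l) b x <= T.
Proof.
move=> ul jl fs le_T T0.
suff : lead l + \sum_(x <- [::]) a x + \sum_(x <- l) b x <= T.
  by rewrite big_nil addr0.
have a0 x : x \in l -> 0 <= a x by move=> /ab_bound[].
have b0 x : x \in l -> 0 <= b x by move=> /ab_bound[].
have [_ st d1 _] := fs.
have order u x : u \in l -> x \in l -> x != u ->
    ~~ (S1 x + a x <= S1 u) -> S1 u + a u <= S1 x + a x.
  move=> lu lx nxu; rewrite -ltNge => h.
  by have [|] := d1 x u lx lu nxu; have := a0 x lx; lra.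
apply: lead_le_sum => [p x q lE|]; last first.
  rewrite -[T]subr0; apply: (packing (S := S1)) => // x lx.
  by rewrite (fs_ge0 fs) //; have := st x lx; have := b0 x lx; have := le_T x lx; lra.
rewrite /=.
have lx : x \in l by rewrite lE mem_cat mem_head orbT.
have lp y : y \in p -> y \in l by move=> yp; rewrite lE mem_cat yp.
have lq y : y \in q -> y \in l by move=> yq; rewrite lE mem_cat inE yq !orbT.
have [jp jq] : {in p, forall y, johnson_key c y <= johnson_key c x} /\
               {in q, forall y, johnson_key c x <= johnson_key c y}.
  move: jl; rewrite /johnson lE pairwise_cat /= => /and3P[/allrelP apx _].
  move=> /andP[/allP aq _]; split=> [y yp|y /aq //].
  by apply: apx; rewrite ?mem_head.
have sumE (Q : pred J) : \sum_(y <- l) (if Q y then a y else b y) =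
    \sum_(y <- p) (if Q y then a y else b y) +
    ((if Q x then a x else b x) + \sum_(y <- q) (if Q y then a y else b y)).
  by rewrite lE big_cat big_cons.
have uE : [/\ x \notin p, x \notin q & {in q, forall y, y \notin p}].
  move: ul; rewrite lE cat_uniq /= negb_or => /and3P[_ /andP[-> h] /andP[-> _]].
  by split=> // y yq; apply: contra h => yp; apply/hasP; exists y.
have [xp xq qp] := uE.
have [abx|bax] := leP (a x) (b x).
  (* These jobs follow [x] in the first half, so their [a] is at least [a x], and any of them can
     replace [x] as the bottleneck. *)
  pose U := [seq y <- x :: q | a y <= b y].
  have xU : x \in U by rewrite mem_filter abx mem_head.
  have [u uU umin] : exists2 u, u \in U & {in U, forall y, S1 u + a u <= S1 y + a y}.
    by move: xU; case: (U) => // z s _; apply: (seq_argmin (fun y => S1 y + a y)).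
  have lU y : y \in U -> y \in l.
    by rewrite mem_filter inE => /andP[_ /predU1P[-> //|/lq]].
  have axu : a x <= a u.
    move: (uU); rewrite mem_filter inE => /andP[abu /predU1P[-> //|uq]].
    by have [] := johnson_key_le1 (lq u uq) lx abu (jq u uq).
  (* The jobs of [U], in particular [x], have to count with [b]; by [umin] none of them finishes
     before [u]. *)
  pose W := [pred y | (y \notin U) && (S1 y + a y <= S1 u)].
  have : a u + \sum_(y <- l) (if W y then a y else b y) <= T.
    apply: (@bottleneck l S1 S2 T u W) => //; first exact: lU.
      by move=> y ly /andP[].
    move=> y ly /=; rewrite negb_and negbK => /orP[/umin //|].
    by have [->|nyu] := eqVneq y u => //; apply: order => //; apply: lU.
  rewrite sumE /= xU /=; apply: le_trans.
  (* Either choice made by [W] is at least the term of the path: [a <= b] on [p], and a job of [q]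
     that counts with [a] lies outside [U], so [b < a] there. *)
  have : \sum_(y <- p) a y <= \sum_(y <- p) (if W y then a y else b y).
    apply: ler_sum_in => y yp; case: ifP => // _.
    by have [] := johnson_key_le1 lx (lp y yp) abx (jp y yp).
  have : \sum_(y <- q) b y <= \sum_(y <- q) (if W y then a y else b y).
    apply: ler_sum_in => y yq; case: ifP => // /andP[+ _].
    by rewrite mem_filter inE yq orbT andbT -ltNge => /ltW.
  by move: axu; rewrite /=; lra.
pose U := [seq y <- x :: p | b y < a y].
have xU : x \in U by rewrite mem_filter bax mem_head.
have [u uU umax] :
    exists2 u, u \in U & {in U, forall y, S1 y + a y <= S1 u + a u}.
  have [u uU umax] : exists2 u, u \in U & {in U, forall y, - (S1 u + a u) <= - (S1 y + a y)}.
    by move: xU; case: (U) => // z s _; apply: (seq_argmin (fun y => - (S1 y + a y))).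
  by exists u => // y /umax; rewrite lerN2.
have lU y : y \in U -> y \in l.
  by rewrite mem_filter inE => /andP[_ /predU1P[-> //|/lp]].
have bxu : b x <= b u.
  move: (uU); rewrite mem_filter inE => /andP[bau /predU1P[-> //|up]].
  by have [] := johnson_key_le2 (lp u up) lx bau (jp u up).
pose W := [pred y | (y != u) && (S1 y + a y <= S1 u)].
(* The bottleneck sum contains both [a u] and [b u]. Regarding [a u] as the term of [u] in the sum
   and [b u] as the extra one makes all of [U], hence [x], count with [a]. *)
pose V := [pred y | W y || (y == u)].
have UV y : y \in U -> V y.
  move=> yU; rewrite /=; have [//|nyu] := eqVneq y u; rewrite orbF.
  (* In the other case [y] follows [u] but finishes no later, so [a y <= 0], against
     [0 <= b y < a y]. *)
  have [//|] := d1 y u (lU y yU) (lU u uU) nyu.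
  have := umax y yU; have := b0 y (lU y yU).
  by move: yU; rewrite mem_filter => /andP[bay _]; lra.
have : a u + \sum_(y <- l) (if W y then a y else b y) <= T.
  apply: (@bottleneck l S1 S2 T u W) => //; first exact: lU.
    by move=> y ly /andP[].
  move=> y ly /=; have [-> //|nyu] := eqVneq y u => h.
  by apply: order => //; apply: lU.
have -> : a u + \sum_(y <- l) (if W y then a y else b y) =
          b u + \sum_(y <- l) (if V y then a y else b y).
  rewrite !(bigD1_seq u) ?lU //= eqxx /= addrCA; congr (_ + (_ + _)).
  by apply: eq_bigr => y /negPf ->; rewrite orbF.
rewrite sumE; apply: le_trans.
rewrite (UV x xU).
have : \sum_(y <- p) a y <= \sum_(y <- p) (if V y then a y else b y).
  apply: ler_sum_in => y yp; case: ifPn => // nV; rewrite leNgt.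
  apply: contra nV => bay; apply: UV.
  by rewrite mem_filter bay inE yp orbT.
have : \sum_(y <- q) b y <= \sum_(y <- q) (if V y then a y else b y).
  apply: ler_sum_in => y yq; case: ifP => // _; apply: ltW.
  by have [] := johnson_key_le2 lx (lq y yq) bax (jq y yq).
by move: bxu; lra.
Qed.

End Bounded.

(** * Merging the two halves with bounded head start *)

Section Merge.
Variables (P : R).
Hypothesis P_ge0 : 0 <= P.
Implicit Type s : R.

Definition bounded l :=
  {in l, forall x, [/\ 0 <= a x, a x <= P, 0 <= b x & b x <= P]}.

Lemma bounded_tl x l : bounded (x :: l) -> bounded l.
Proof. by move=> bl y yl; apply: bl; rewrite inE yl orbT. Qed.

Lemma lead_ge0 l : bounded l -> 0 <= lead l.
Proof.
case: l => //= x l /(_ x (mem_head _ _))[ax0 _ _ _].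
by rewrite le_max ax0.
Qed.

Lemma lead_le1 l : bounded l -> all (fun x => a x <= b x) l -> lead l <= P.
Proof.
elim: l => //= x l IH bl /andP[abx /(IH (bounded_tl bl)) le_P].
by have [_ ax _ _] := bl x (mem_head _ _); rewrite ge_max ax; lra.
Qed.

(** The induction needs the stronger bound [P] plus the positive part of the excess of the total of
    [a] over that of [b]. A job [x] changes both [lead] and the excess by [a x - b x], except where
    [lead] is reset to [a x <= P]. *)
Lemma lead_le_bound l1 l2 : bounded (l1 ++ l2) ->
  all (fun x => a x <= b x) l1 -> all (fun x => b x < a x) l2 ->
  \sum_(x <- l1 ++ l2) a x <= \sum_(x <- l1 ++ l2) b x -> lead (l1 ++ l2) <= P.
Proof.
move=> bl l1P l2P ab.
pose excess l := \sum_(x <- l) a x - \sum_(x <- l) b x.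
suff : lead (l1 ++ l2) <= P + Num.max 0 (excess (l1 ++ l2)).
  by rewrite (max_idPl _) ?addr0 // /excess subr_le0.
have excess_cons x l : excess (x :: l) = excess l + (a x - b x).
  by rewrite /excess !big_cons; ring.
have le_max0 (u v : R) : 0 <= Num.max u v - u /\ 0 <= Num.max u v - v.
  by rewrite !subr_ge0 !le_max !lexx orbT.
elim: l1 l1P bl {ab} => [_|x l1 IH /= /andP[abx /IH]] /=.
  suff h : bounded l2 -> 0 <= excess l2 /\ lead l2 <= P + excess l2.
    by move=> /h[h0]; rewrite (max_idPr h0).
  elim: l2 l2P => [_ _|x l2 IH /= /andP[bax /IH + bl]].
    by rewrite /excess !big_nil subrr addr0.
  move=> /(_ (bounded_tl bl)); rewrite excess_cons ge_max.
  by have [_ ax _ _] := bl x (mem_head _ _); lra.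
move=> + bl; move=> /(_ (bounded_tl bl)).
have [_ ax _ _] := bl x (mem_head _ _).
rewrite excess_cons ge_max.
have := le_max0 0 (excess (l1 ++ l2) + (a x - b x)).
have [h|h] := leP 0 (excess (l1 ++ l2)) => -[]; lra.
Qed.

(** Moving [y] in front of [l1] leaves the head start at the beginning of [l2] unchanged. Only the
    jobs of [l1] see a different one, which the second hypothesis covers. *)
Lemma lead_skip l1 y l2 s : lead (l1 ++ y :: l2) <= s ->
  lead l1 <= s + (b y - a y) -> lead (l1 ++ l2) <= s + (b y - a y).
Proof.
elim: l1 s => [|x l1 IH] s /=; first by rewrite ge_max => /andP[_]; lra.
rewrite !ge_max => /andP[ax le_s] /andP[-> le_sy] /=.
have := IH (s + (b x - a x)); lra.
Qed.

(* The invariant of the merge of the two halves l1 and l2 of the Johnson order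
   into the final order; s is the time left before the second machine needs
   the next job. *)
Definition ahead l1 l2 s :=
  lead (l1 ++ l2) <= s /\ (l2 <> [::] -> s <= 2 * P).

(** While [l2] is not empty, the new head start is below [P + max(b x, lead l1)], hence at most
    [2 * P]. Once it is empty, truncating [s] at [2 * P] does no harm, because [lead l1 <= P]. *)
Lemma ahead_step1 x l1 l2 s : bounded (x :: l1 ++ l2) ->
  all (fun x => a x <= b x) (x :: l1) -> ahead (x :: l1) l2 s ->
  (l2 = [::] \/ s < P + lead (x :: l1)) ->
  a x <= Num.min s (2 * P) /\
  ahead l1 l2 (Num.min s (2 * P) + (b x - a x)).
Proof.
move=> bl /= /andP[abx l1P] [le_s s_le2].
have [ax0 axP bx0 bxP] := bl x (mem_head _ _).
have bl1 : bounded l1.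
  by move=> y yl; apply: bl; rewrite inE mem_cat yl orbT.
have le_P := lead_le1 bl1 l1P.
move: le_s; rewrite /ahead /= ge_max => /andP[axs le_s].
have [l2E|/eqP nl2] := eqVneq l2 [::].
  move=> _; split; first by rewrite le_min axs; lra.
  split=> //; rewrite l2E cats0 in le_s *.
  by rewrite -lerBlDr le_min; apply/andP; split; lra.
case=> // hs; have h2 := s_le2 nl2.
rewrite (min_idPl h2); split=> //; split=> [|_]; first lra.
move: hs; have [h|h] := leP (a x) (lead l1 - (b x - a x)); lra.
Qed.

(** The job [y] lowers the head start by at most [P]. The margin [P] over [lead l1] pays for this,
    and [lead_skip] takes care of [l2]. *)
Lemma ahead_step2 y l1 l2 s : bounded (l1 ++ y :: l2) ->
  b y < a y -> ahead l1 (y :: l2) s -> (l1 = [::] \/ P + lead l1 <= s) ->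
  a y <= Num.min s (2 * P) /\
  ahead l1 l2 (Num.min s (2 * P) + (b y - a y)).
Proof.
move=> bl bay [le_s s_le2].
have [ay0 ayP by0 byP] : [/\ 0 <= a y, a y <= P, 0 <= b y & b y <= P].
  by apply: bl; rewrite mem_cat mem_head orbT.
have bl1 : bounded l1 by move=> z zl; apply: bl; rewrite mem_cat zl.
have h2 : s <= 2 * P by apply: s_le2.
rewrite (min_idPl h2) /ahead => l1P.
have ays : a y <= s.
  case: l1P => [l10|]; last by have := lead_ge0 bl1; lra.
  by move: le_s; rewrite l10 /= ge_max => /andP[].
split=> //; split=> [|_]; last lra.
case: l1P => [l10|hs].
  by move: le_s; rewrite l10 /= ge_max => /andP[_]; lra.
apply: lead_skip => //; lra.
Qed.

(* The jobs in l occupy the machines until the times t - s and t. *)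
Record placed (d : R) l (S1 S2 : J -> R) s (t : R) : Prop := Placed {
  placed_s : s <= t;
  placed_t : t = d + \sum_(x <- l) b x;
  placed_end : {in l, forall x, S1 x + a x <= t - s /\ S2 x + b x <= t};
  placed_flow : {in l, forall x, S2 x <= S1 x + 2 * P};
  placed_shop : flow_shop l a b S1 S2
}.

Lemma placed_nil d S1 S2 : placed d [::] S1 S2 d d.
Proof. by split=> //; rewrite big_nil addr0. Qed.

(** The second machine takes [x] at time [t] without a pause. The first one waits, if [s] exceeds
    [2 * P], so that [x] starts on the second machine at most [2 * P] after it started on the
    first. *)
Lemma placed_cons d l S1 S2 s t x S1' S2' :
  placed d l S1 S2 s t -> x \notin l -> 0 <= a x -> 0 <= b x ->
  a x <= Num.min s (2 * P) ->
  {in l, S1' =1 S1} -> {in l, S2' =1 S2} ->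
  S1' x = t - Num.min s (2 * P) -> S2' x = t ->
  placed d (x :: l) S1' S2' (Num.min s (2 * P) + (b x - a x)) (t + b x).
Proof.
move=> [st tE le_end flow [S10 stage d1 d2]] xl ax0 bx0 axs e1 e2 e1x e2x.
have nx y : y \in l -> y != x by apply: contraTneq => ->.
have [ms m2] : Num.min s (2 * P) <= s /\ Num.min s (2 * P) <= 2 * P.
  by rewrite !ge_min !lexx orbT.
set m := Num.min _ _ in axs e1x ms m2 *.
split; last split.
- by lra.
- by rewrite big_cons tE; ring.
- move=> y /predU1P[->|yl]; first by rewrite e1x e2x; lra.
  by rewrite e1 ?e2 //; have := le_end y yl; lra.
- move=> y /predU1P[->|yl]; first by rewrite e1x e2x; lra.
  by rewrite e1 ?e2 // flow.
- by move=> y /predU1P[->|yl]; [rewrite e1x; lra | rewrite e1 ?S10].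
- by move=> y /predU1P[->|yl]; [rewrite e1x e2x; lra | rewrite e1 ?e2 ?stage].
- move=> y z /predU1P[->|yl] /predU1P[->|zl]; rewrite ?eqxx // ?e1x ?e1 //.
  + by move=> _; right; have := le_end z zl; lra.
  + by move=> _; left; have := le_end y yl; lra.
  + exact: d1.
- move=> y z /predU1P[->|yl] /predU1P[->|zl]; rewrite ?eqxx // ?e2x ?e2 //.
  + by move=> _; right; have := le_end z zl; lra.
  + by move=> _; left; have := le_end y yl; lra.
  + exact: d2.
Qed.

End Merge.
End Johnson.
End FlowShop.

(** * Time-bounded execution *)

Section Execution.
Variable R : realType.
Implicit Types (m : memory R) (p q : program) (b : test) (e : expr).
Implicit Types (Q : memory R -> Prop) (c : nat).

(** A Hoare triple for total correctness with a time bound. *)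
Definition runs p m c Q :=
  exists t m', [/\ exec p m t m', (t <= c)%N & Q m'].

(** Effects are tracked by whole arrays, which is precise enough because each scalar variable has an
    array of its own. *)
Fixpoint writes p : seq nat :=
  match p with
  | Skip => [::]
  | Write k _ _ => [:: k]
  | Seq p1 p2 | If _ p1 p2 => writes p1 ++ writes p2
  | While _ p1 => writes p1
  end.

Lemma exec_frame {p m t m'} :
  exec p m t m' -> forall k, k \notin writes p -> m' k = m k.
Proof.
elim=> //=.
- move=> {}m k e1 e2 k'; rewrite inE /update => nk.
  by apply/funext => i; rewrite (negPf nk).
- move=> p1 p2 m0 t1 m1 t2 m2 _ IH1 _ IH2 k.
  by rewrite mem_cat negb_or => /andP[k1 k2]; rewrite IH2 // IH1.
- move=> b p1 p2 m0 t0 m1 _ IH k; rewrite mem_cat negb_or => /andP[k1 k2].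
  by apply: IH; case: ifP.
- move=> b q m0 t1 m1 t2 m2 _ _ IH1 _ IH2 k nk.
  by rewrite IH2 // IH1.
Qed.

Lemma runs_frame p m c Q : runs p m c Q ->
  runs p m c (fun m' => Q m' /\ forall k, k \notin writes p -> m' k = m k).
Proof.
move=> [t [m' [ex tc Qm']]]; exists t, m'; split=> //; split=> //.
exact: exec_frame ex.
Qed.

Lemma runs_weaken p m c c' Q Q' : (c <= c')%N -> (forall m', Q m' -> Q' m') ->
  runs p m c Q -> runs p m c' Q'.
Proof.
move=> cc QQ [t [m' [ex tc Qm']]]; exists t, m'.
by split; [|exact: leq_trans cc|exact: QQ].
Qed.

Lemma runs_seq p q m c1 c2 Q1 Q :
  runs p m c1 Q1 -> (forall m', Q1 m' -> runs q m' c2 Q) ->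
  runs (Seq p q) m (c1 + c2) Q.
Proof.
move=> [t1 [m1 [ex1 tc1 /[swap] /[apply]]]] [t2 [m2 [ex2 tc2 Qm2]]].
by exists (t1 + t2)%N, m2; split=> //; [exact: ExecSeq ex2 | exact: leq_add].
Qed.

Lemma runs_if b p q m c Q : runs (if eval_test m b then p else q) m c Q ->
  runs (If b p q) m (cost_test b + c) Q.
Proof.
move=> [t [m' [ex tc Qm']]]; exists (cost_test b + t)%N, m'; split=> //.
  exact: ExecIf.
by rewrite leq_add2l.
Qed.

(** The index of the invariant bounds the number of remaining iterations, so it gives both
    termination and the cost. The loop may stop before the index reaches 0. *)
Lemma runs_while b p c (Inv : nat -> memory R -> Prop) k m :
  (forall k m, Inv k m -> eval_test m b ->
     exists2 k', k = k'.+1 & runs p m c (Inv k')) ->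
  Inv k m ->
  runs (While b p) m (k * (cost_test b + c) + cost_test b)
    (fun m' => ~~ eval_test m' b /\ exists k', Inv k' m').
Proof.
move=> step; elim/ltn_ind: k m => k IH m Ik.
have [bm|bm] := boolP (eval_test m b); last first.
  exists (cost_test b), m; split; [exact: ExecWhileDone | exact: leq_addl |].
  by split=> //; exists k.
have [k' kE [t1 [m1 [ex1 tc1 Ik']]]] := step k m Ik bm.
have [|t2 [m2 [ex2 tc2 Qm2]]] := IH k' _ m1 Ik'; first by rewrite kE.
exists (cost_test b + t1 + t2)%N, m2; split=> //.
  exact: ExecWhileStep ex2.
by rewrite kE mulSn; lia.
Qed.

(** * Symbolic execution of loop-free programs *)

Fixpoint loop_free p : bool :=
  match p with
  | Skip | Write _ _ _ => true
  | Seq p1 p2 | If _ p1 p2 => loop_free p1 && loop_free p2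
  | While _ _ => false
  end.

(** The values of [run] and [max_cost] on [While] are dummies. *)
Fixpoint run p m : memory R :=
  match p with
  | Write k e1 e2 => update m k (Num.truncn (eval m e1)) (eval m e2)
  | Seq p1 p2 => run p2 (run p1 m)
  | If b p1 p2 => if eval_test m b then run p1 m else run p2 m
  | Skip | While _ _ => m
  end.

Fixpoint max_cost p : nat :=
  match p with
  | Skip => 1
  | Write _ e1 e2 => (cost e1 + cost e2).+1
  | Seq p1 p2 => max_cost p1 + max_cost p2
  | If b p1 p2 => cost_test b + maxn (max_cost p1) (max_cost p2)
  | While _ _ => 0
  end.

Lemma runs_loop_free p m Q : loop_free p -> Q (run p m) ->
  runs p m (max_cost p) Q.
Proof.
suff ex : loop_free p -> exists2 t, exec p m t (run p m) & (t <= max_cost p)%N.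
  by move=> /ex[t ext tc] Qm; exists t, (run p m).
elim: p m {Q} => //=.
- by move=> m _; exists 1%N => //; exact: ExecSkip.
- by move=> k e1 e2 m _; eexists; [exact: ExecWrite | rewrite leqnn].
- move=> p IHp q IHq m /andP[/IHp-/(_ m)[t1 ex1 tc1] /IHq-/(_ (run p m))[t2 ex2 tc2]].
  by exists (t1 + t2)%N; [exact: ExecSeq ex2 | exact: leq_add].
- move=> b p IHp q IHq m /andP[/IHp-/(_ m)[t1 ex1 tc1] /IHq-/(_ m)[t2 ex2 tc2]].
  case bm: (eval_test m b).
    exists (cost_test b + t1)%N; first by apply: ExecIf; rewrite bm.
    by rewrite leq_add2l leq_max tc1.
  exists (cost_test b + t2)%N; first by apply: ExecIf; rewrite bm.
  by rewrite leq_add2l leq_max tc2 orbT.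
Qed.

Lemma runs_straight p m c Q : loop_free p -> (max_cost p <= c)%N -> Q (run p m) ->
  runs p m c Q.
Proof. by move=> lf pc Qm; exact: runs_weaken pc _ (runs_loop_free lf Qm). Qed.

Lemma run_frame p m k : k \notin writes p -> run p m k = m k.
Proof.
elim: p m => //= [k' e1 e2|p IHp q IHq|b p IHp q IHq] m.
- by rewrite inE => nk; apply/funext => i; rewrite /update (negPf nk).
- by rewrite mem_cat negb_or => /andP[kp kq]; rewrite IHq ?IHp.
- by rewrite mem_cat negb_or => /andP[kp kq]; case: ifP => _; [rewrite IHp|rewrite IHq].
Qed.

Lemma updateE m k i (x : R) j : update m k i x k j = if j == i then x else m k j.
Proof. by rewrite /update eqxx. Qed.

Lemma updateNE m k i (x : R) k' : k' != k -> update m k i x k' = m k'.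
Proof. by move=> /negPf h; apply/funext => j; rewrite /update h. Qed.

(** * Scalar variables and counting loops *)

Definition Var k := Read k (Const 0).
Definition Assign k e := Write k (Const 0) e.

Lemma eval_var m k : eval m (Var k) = m k 0%N.
Proof. by rewrite /= mulr0z -[0]/(0%:R) natrK. Qed.

Lemma eval_read m k e i : eval m e = i%:R -> eval m (Read k e) = m k i.
Proof. by move=> /= ->; rewrite natrK. Qed.

(** A bundle of rewrite rules. Plain simplification would unfold each variable into a memory cell
    with a truncated index. *)
Lemma evalE m :
  ((forall k, eval m (Var k) = m k 0%N) *
   (forall z, eval m (Const z) = z%:~R) *
   (forall e1 e2, eval m (Add e1 e2) = (eval m e1 + eval m e2)%R) *
   (forall e1 e2, eval m (Sub e1 e2) = (eval m e1 - eval m e2)%R) *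
   (forall e1 e2, eval m (Mul e1 e2) = (eval m e1 * eval m e2)%R) *
   (forall e1 e2, eval m (Div e1 e2) = (eval m e1 / eval m e2)%R) *
   (forall e1 e2, eval_test m (Le e1 e2) = (eval m e1 <= eval m e2)%R) *
   (forall e1 e2, eval_test m (Lt e1 e2) = (eval m e1 < eval m e2)%R) *
   (forall b, eval_test m (Not b) = ~~ eval_test m b) *
   (forall b1 b2, eval_test m (And b1 b2) =
      eval_test m b1 && eval_test m b2))%type.
Proof. by do !split=> //; exact: eval_var. Qed.

Definition For p :=
  Seq (Assign 9 (Const 0))
    (While (Lt (Var 9) (Var 0))
       (Seq p (Assign 9 (Add (Var 9) (Const 1))))).

Lemma run_write m k e1 e2 i : eval m e1 = i%:R ->
  run (Write k e1 e2) m = update m k i (eval m e2).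
Proof. by move=> /= ->; rewrite natrK. Qed.

Lemma run_assign k e m : run (Assign k e) m = update m k 0 (eval m e).
Proof. exact: run_write. Qed.

Lemma run_seq p q m : run (Seq p q) m = run q (run p m).
Proof. by []. Qed.

Lemma run_if b p q m :
  run (If b p q) m = if eval_test m b then run p m else run q m.
Proof. by []. Qed.

(** Initialising the counter costs 3, each of the [n + 1] tests 5 and each increment 6. The
    invariant has to ignore the counter, which is incremented after the body. *)
Lemma runs_for p n c (Inv : nat -> memory R -> Prop) m :
  m 0%N 0%N = n%:R -> 0%N \notin writes p -> 9%N \notin writes p ->
  (forall j m' x, Inv j m' -> Inv j (update m' 9 0 x)) -> Inv 0%N m ->
  (forall j m', (j < n)%N -> m' 9%N 0%N = j%:R ->
     (forall k, k \notin 9%N :: writes p -> m' k = m k) ->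
     Inv j m' -> runs p m' c (Inv j.+1)) ->
  runs (For p) m (n * (c + 11) + 8)
    (fun m' => Inv n m' /\ forall k, k \notin 9%N :: writes p -> m' k = m k).
Proof.
move=> m0 p0 p9 Inv9 Inv0 step.
pose J k m' := exists j, [/\ k = (n - j)%N, (j <= n)%N, m' 9%N 0%N = j%:R,
  forall k, k \notin 9%N :: writes p -> m' k = m k & Inv j m'].
pose m1 := update m 9 0 (0 : R).
have J0 : J n m1.
  exists 0%N; split; rewrite ?subn0 //; last exact: Inv9.
  by move=> k; rewrite inE negb_or => /andP[k9 _]; rewrite /m1 updateNE.
have test_lt j m' (j9 : m' 9%N 0%N = j%:R) : m' 0%N 0%N = n%:R ->
    eval_test m' (Lt (Var 9) (Var 0)) = (j < n)%N.
  by move=> n0; rewrite /eval_test !eval_var j9 n0 ltr_nat.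
have nw0 : 0%N \notin 9%N :: writes p by rewrite inE.
pose body := Seq p (Assign 9 (Add (Var 9) (Const 1))).
have := @runs_while (Lt (Var 9) (Var 0)) body (c + 6) J n m1 _ J0.
rewrite (_ : n * (c + 11) + 8 = 3 + (n * (5 + (c + 6)) + 5))%N; last by lia.
move=> H; apply: (@runs_seq _ _ _ 3 _ (eq m1)) => [|_ <-].
  apply: (@runs_loop_free (Assign 9 (Const 0))) => //.
  by rewrite run_assign /= mulr0z.
apply: runs_weaken (leqnn _) _ (H _) => {H} [m' [nt [_ [j [_ jn j9 fr Ij]]]]|].
  move: nt; rewrite (test_lt _ _ j9) ?fr // -leqNgt => nj.
  by rewrite (_ : n = j) //; apply/eqP; rewrite eqn_leq nj.
move=> k m' [j [kE jn j9 fr Ij]]; rewrite (test_lt _ _ j9) ?fr // => jn'.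
exists (n - j.+1)%N; first by rewrite kE; lia.
apply: (@runs_seq _ _ _ c 6
  (fun m2 => Inv j.+1 m2 /\ forall k, k \notin writes p -> m2 k = m' k)).
  exact/runs_frame/step.
move=> m2 [Ij2 fr2]; apply: (@runs_loop_free (Assign 9 (Add (Var 9) (Const 1)))) => //.
rewrite run_assign; exists j.+1; split=> //; last exact: Inv9.
- by rewrite updateE eqxx !evalE fr2 // j9 -natr1.
- move=> k'; rewrite inE negb_or => /andP[k9 kw]; rewrite updateNE // fr2 //.
  by rewrite fr // inE negb_or k9.
Qed.
End Execution.

(** * The algorithm *)

(* Arrays: 5 sorting keys, 6 tournament tree, 7 Johnson's order, 8 head starts
   needed by the suffixes of the first half of that order. Scalars, in the cells
   of index 0: 9 loop counter, 10 array index, 11 current job, 12 difference of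
   the total loads, 13 and 14 head starts, 15 size of the first half, 16 and 17
   positions in the two halves, 18 and 19 the variables s and t of placed. *)

Definition cap := Read 0 (Const 1).

(** * The tournament tree *)

Definition play_match :=
  let left := Mul (Const 2) (Var 10) in
  let right := Add left (Const 1) in
  If (Le (Read 5 (Read 6 left)) (Read 5 (Read 6 right)))
    (Write 6 (Var 10) (Read 6 left)) (Write 6 (Var 10) (Read 6 right)).

Section Sorting.
Variables (R : realType) (n : nat).
Implicit Types (m : memory R).

(* Node v of the tree has the children 2v and 2v + 1 and holds the job of
   least key among the leaves n, ..., 2n - 1 below it. *)
Definition key m v : R := m 5%N (Num.truncn (m 6%N v)).

Definition node m v :=
  [/\ m 6%N v = m 6%N (2 * v)%N \/ m 6%N v = m 6%N (2 * v).+1,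
      key m v <= key m (2 * v)%N & key m v <= key m (2 * v).+1].

Definition leaves m := forall j, (j < n)%N -> m 6%N (n + j)%N = j%:R.

Lemma eval_cap m : eval m cap = m 0%N 1%N.
Proof. exact: (@eval_read _ _ _ _ 1). Qed.

Lemma run_play_match m v : m 10%N 0%N = v%:R ->
  exists2 c, c = (2 * v)%N \/ c = (2 * v).+1 &
    [/\ run play_match m = update m 6 v (m 6%N c),
        key m c <= key m (2 * v)%N & key m c <= key m (2 * v).+1].
Proof.
move=> mv.
have lE : eval m (Mul (Const 2) (Var 10)) = (2 * v)%:R.
  by rewrite !evalE mv natrM.
have rE : eval m (Add (Mul (Const 2) (Var 10)) (Const 1)) = (2 * v).+1%:R.
  by rewrite evalE lE evalE -natr1.
have vE : eval m (Var 10) = v%:R by rewrite evalE.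
have keyE e c : eval m e = c%:R -> eval m (Read 5 (Read 6 e)) = key m c.
  by move=> ec; rewrite /key /= ec natrK.
rewrite /play_match run_if evalE (keyE _ _ lE) (keyE _ _ rE).
case: leP => [h|/ltW h]; [exists (2 * v)%N|exists (2 * v).+1]; try by [left|right].
  by split=> //; rewrite (run_write _ _ vE) (eval_read _ lE).
by split=> //; rewrite (run_write _ _ vE) (eval_read _ rE).
Qed.

Lemma node_update m v c : (0 < v)%N -> c = (2 * v)%N \/ c = (2 * v).+1 ->
  key m c <= key m (2 * v)%N -> key m c <= key m (2 * v).+1 ->
  node (update m 6 v (m 6%N c)) v.
Proof.
move=> v0 cE h1 h2; rewrite /node /key !updateE !updateNE // eqxx.
have [/negPf-> /negPf->] : (2 * v)%N != v /\ (2 * v).+1 != v by split; lia.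
by split=> //; case: cE => ->; [left|right].
Qed.

Lemma node_frame m m' v : (0 < v)%N -> (forall j, m' 5%N j = m 5%N j) ->
  (forall w, w = v \/ w = (2 * v)%N \/ w = (2 * v).+1 -> m' 6%N w = m 6%N w) ->
  node m v -> node m' v.
Proof.
move=> v0 e5 e6 [h1 h2 h3]; split;
  rewrite /key ?e5 ?(e6 v) ?(e6 (2 * v)%N) ?(e6 (2 * v).+1);
  by [|left|right; left|right;right].
Qed.

Section Tree.
Variable m : memory R.
Hypotheses (m_leaves : leaves m) (m_nodes : forall v, (0 < v < n)%N -> node m v).

(** Following the winner down from [w] leads to the leaf [n + j] of that job. Conversely [w] arises
    from [n + j] by repeated halving, which later tells the nodes that a change of one key can
    affect. *)
Lemma tree_value w : (0 < w < 2 * n)%N ->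
  exists2 j, (j < n)%N & m 6%N w = j%:R /\ exists k, w = ((n + j) %/ 2 ^ k)%N.
Proof.
have [k] := ubnP (2 * n - w)%N; elim: k w => // k IH w wk w2n.
have [wn|nw] := ltnP w n; last first.
  exists (w - n)%N; first lia; split; last by exists 0%N; rewrite divn1; lia.
  by rewrite -m_leaves; [congr (m _ _) |]; lia.
have [[h|h] _ _] := @m_nodes w ltac:(lia).
  have [| |j jn [jE [i iE]]] := IH (2 * w)%N; try lia.
  exists j => //; split; first by rewrite h.
  by exists i.+1; rewrite expnSr divnMA -iE mulKn.
have [| |j jn [jE [i iE]]] := IH (2 * w).+1; try lia.
exists j => //; split; first by rewrite h.
by exists i.+1; rewrite expnSr divnMA -iE; lia.
Qed.

Lemma tree_min w : (0 < w < 2 * n)%N -> key m 1 <= key m w.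
Proof.
elim/ltn_ind: w => w IH wn; have [->//|w1] := eqVneq w 1%N.
apply: (le_trans (IH (w %/ 2)%N _ _)); try lia.
have [_ h1 h2] := @m_nodes (w %/ 2)%N ltac:(lia).
have [e|e] : w = (2 * (w %/ 2))%N \/ w = (2 * (w %/ 2)).+1 by lia.
  by rewrite {2}e.
by rewrite {2}e.
Qed.

Lemma tree_root : (0 < n)%N -> exists2 j, (j < n)%N &
  m 6%N 1%N = j%:R /\ forall i, (i < n)%N -> m 5%N j <= m 5%N i.
Proof.
move=> n0; have [|j jn [jE _]] := @tree_value 1; first lia.
exists j => //; split=> // i ni; have := @tree_min (n + i)%N ltac:(lia).
by rewrite /key jE m_leaves // !natrK.
Qed.

End Tree.

Definition climb :=
  While (Le (Const 2) (Var 10))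
    (Seq (Assign 10 (Floor (Div (Var 10) (Const 2)))) play_match).

Lemma floor_half (v : nat) : (Num.floor (v%:R / 2 : R))%:~R = (v %/ 2)%:R :> R.
Proof.
rewrite -[RHS]/(((v %/ 2)%N : int)%:~R); congr _%:~R; apply: floor_def.
rewrite intrD -!pmulrn ler_pdivlMr // ltr_pdivrMr // natr1 -!natrM.
by rewrite ler_nat ltr_nat; lia.
Qed.

(** The invariant allows wrong matches only at the proper ancestors of the current node [c], and [k]
    bounds the levels above it. A round costs 4 for the test and 32 for the body. *)
Lemma runs_climb m c k : m 10%N 0%N = c%:R -> (0 < c < 2 * n)%N ->
  (c < 2 ^ k.+1)%N -> leaves m ->
  (forall w, (0 < w < n)%N -> node m w \/ exists i, w = (c %/ 2 ^ i.+1)%N) ->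
  runs climb m (k * 36 + 4) (fun m' => leaves m' /\ forall w, (0 < w < n)%N -> node m' w).
Proof.
move=> mc cn ck ml mw.
pose Inv k m' := exists c, [/\ m' 10%N 0%N = c%:R, (0 < c < 2 * n)%N,
  (c < 2 ^ k.+1)%N, leaves m' &
  forall w, (0 < w < n)%N -> node m' w \/ exists i, w = (c %/ 2 ^ i.+1)%N].
have := @runs_while _ (Le (Const 2) (Var 10))
  (Seq (Assign 10 (Floor (Div (Var 10) (Const 2)))) play_match) 32 Inv k m _.
have testE m' c' : m' 10%N 0%N = c'%:R -> eval_test m' (Le (Const 2) (Var 10)) = (2 <= c')%N.
  by move=> cE; rewrite !evalE cE -[2%:~R]/(2%:R) ler_nat.
move=> H; apply: runs_weaken (H _ _) => {H}.
- done.
- move=> m' [+ [k' [c' [cE cn' _ lv nd]]]].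
  rewrite (testE _ _ cE) => c2; split=> // w wn.
  have [//|[i wE]] := nd w wn.
  have c1 : c' = 1%N by lia.
  move: wn; rewrite wE c1 expnS; rewrite divn_small //.
  by have := expn_gt0 2 i; lia.
- move=> k' m' [c' [cE cn' ck' lv nd]]; rewrite (testE _ _ cE) => c2.
  case: k' ck' => [|k'] ck'; first by move: ck'; rewrite expn1; lia.
  exists k' => //.
  apply: runs_straight => //; rewrite run_seq run_assign.
  set m1 := update _ _ _ _.
  have m1v : m1 10%N 0%N = (c' %/ 2)%:R.
    by rewrite /m1 updateE eqxx /= mulr0z -[0]/(0%:R) natrK cE floor_half.
  have [c'' cc [-> h1 h2]] := run_play_match m1v.
  exists (c' %/ 2)%N; split.
  + by rewrite updateNE.
  + by lia.
  + by move: ck'; rewrite expnS; lia.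
  + move=> j jn; rewrite updateE /m1 updateNE // ifN ?lv //; lia.
  + move=> w wn; have [->|nw] := eqVneq w (c' %/ 2)%N.
      by left; apply: node_update => //; lia.
    have [nd1|[[|i] wE]] := nd w wn.
    (* Replaying a match can spoil the match at the parent only. *)
    * have [e|ne] := eqVneq w (c' %/ 2 %/ 2)%N.
        by right; exists 0%N; rewrite expn1.
      left; apply: node_frame nd1; first lia.
        by move=> j; rewrite updateNE // /m1 updateNE.
      by move=> u uE; rewrite updateE /m1 updateNE // ifN //; lia.
    * by rewrite wE expn1 eqxx in nw.
    * by right; exists i; rewrite wE [(2 ^ i.+2)%N]expnS divnMA.
- by exists c.
Qed.

Definition build_body :=
  Seq (Assign 10 (Sub (Sub (Var 0) (Const 1)) (Var 9))) play_match.

Lemma runs_build m : m 0%N 0%N = n%:R -> leaves m ->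
  runs (For build_body) m (n * 60 + 8) (fun m' =>
    [/\ leaves m', forall w, (0 < w < n)%N -> node m' w &
      forall k, k \notin [:: 6; 9; 10]%N -> m' k = m k]).
Proof.
move=> mn ml.
pose Inv i m' := leaves m' /\ forall w, (n - i <= w)%N -> (0 < w < n)%N -> node m' w.
have := @runs_for _ build_body n 49 Inv m mn.
move=> H; apply: runs_weaken (H _ _ _ _ _) => {H} //.
- move=> m' [[l' nd] fr]; split=> //[w|k nk]; first by apply: nd; rewrite subnn.
  by apply: fr; move: nk; rewrite !inE; lia.
- by split=> //= w; lia.
- move=> i m' ni m9 fr [l' nd]; apply: runs_straight => //.
  rewrite run_seq run_assign !evalE m9 fr // mn.
  (* Nodes are treated from [n - 1] down, children before parents. The last round, at 0, falls
     outside the tree, whose root is 1. *)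
  rewrite (_ : n%:R - 1%:~R - i%:R = (n.-1 - i)%:R); last first.
    by rewrite natrB -?subn1 ?natrB //; lia.
  set m1 := update _ _ _ _; have [v vE] : exists v, v = (n.-1 - i)%N by exists (n.-1 - i)%N.
  have m1v : m1 10%N 0%N = v%:R by rewrite /m1 updateE vE.
  have [c cE [-> h1 h2]] := run_play_match m1v.
  split=> [j jn|w wn wn'].
    by rewrite updateE ifN; [rewrite /m1 updateNE // l'|lia].
  have [wv|nwv] := eqVneq w v; first by rewrite wv; apply: node_update => //; lia.
  apply: (@node_frame m'); [lia| | |by apply: nd; lia].
    by move=> j; rewrite updateNE // /m1 updateNE.
  by move=> u uE; rewrite updateE /m1 updateNE // ifN //; lia.
Qed.

(** * Sorting by repeated extraction *)

(** The new key [2 * cap + 2] exceeds every Johnson key of processing times between 0 and [cap], so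
    the job is removed for good. *)
Definition extract_root :=
  Seq (Assign 11 (Read 6 (Const 1)))
 (Seq (Write 7 (Var 9) (Var 11))
 (Seq (Write 5 (Var 11) (Add (Mul (Const 2) cap) (Const 2)))
      (Assign 10 (Add (Var 0) (Var 11))))).

(** A node won by another job keeps its winner, since that key is unchanged and no key decreases.
    The nodes won by [x] lie above its leaf [n + x]. *)
Lemma node_removed m m' x : leaves m -> (x < n)%N ->
  (forall w, (0 < w < n)%N -> node m w) -> m' 6%N = m 6%N ->
  (forall j, j != x -> m' 5%N j = m 5%N j) -> m 5%N x <= m' 5%N x ->
  forall w, (0 < w < n)%N ->
    node m' w \/ exists i, w = ((n + x) %/ 2 ^ i.+1)%N.
Proof.
move=> ml xn mw e6 e5 m5x w wn.
have [j jn [jE [k wk]]] := tree_value ml mw (w := w) ltac:(lia).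
have [jx|jx] := eqVneq j x.
  right; case: k wk => [|k] wk; last by exists k; rewrite wk jx.
  by move: wn; rewrite wk divn1; lia.
left; have [h1 h2 h3] := mw w wn.
have key_le v : key m v <= key m' v.
  rewrite /key e6; set u := Num.truncn _.
  by have [->|/e5 ->] := eqVneq u x.
have keyw : key m' w = key m w by rewrite /key e6 jE natrK e5.
split; rewrite ?e6 // keyw.
- exact: le_trans h2 (key_le _).
- exact: le_trans h3 (key_le _).
Qed.

Lemma runs_extract m (K : nat -> R) :
  m 0%N 0%N = n%:R -> (forall j, (j < n)%N -> m 5%N j = K j) ->
  (forall j, (j < n)%N -> K j < 2 * m 0%N 1%N + 2) ->
  leaves m -> (forall w, (0 < w < n)%N -> node m w) ->
  runs (For (Seq extract_root climb)) m
    (n * (40 + ((trunc_log 2 n).+1 * 36 + 4) + 11) + 8) (fun m' =>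
    (exists l, [/\ perm_eq l (iota 0 n), pairwise (fun x y => K x <= K y) l &
       forall i, (i < n)%N -> m' 7%N i = (nth 0%N l i)%:R]) /\
    forall k, k \notin [:: 5; 6; 7; 9; 10; 11]%N -> m' k = m k).
Proof.
move=> mn mK KC ml mw; pose top := 2 * m 0%N 1%N + 2.
pose Inv r m' := exists l,
  [/\ [/\ size l = r, uniq l, {in l, forall x, x < n}%N &
        pairwise (fun x y => K x <= K y) l],
     forall x y, x \in l -> y \notin l -> (y < n)%N -> K x <= K y,
     forall i, (i < r)%N -> m' 7%N i = (nth 0%N l i)%:R,
     forall j, (j < n)%N -> m' 5%N j = if j \in l then top else K j &
     leaves m' /\ forall w, (0 < w < n)%N -> node m' w].
have := @runs_for _ (Seq extract_root climb) n (40 + ((trunc_log 2 n).+1 * 36 + 4)) Inv m mn.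
move=> H; apply: runs_weaken (H _ _ _ _ _) => {H} //.
- move=> m' [[l [[sl ul ln pl] _ l7 _ _]] fr]; split.
    exists l; split=> //; apply: uniq_perm (iota_uniq _ _) _ => //.
    have sub : {subset l <= iota 0 n} by move=> x /ln; rewrite mem_iota.
    by have [|] := uniq_min_size ul sub; rewrite ?size_iota ?sl.
  by move=> k nk; apply: fr; move: nk; rewrite !inE; lia.
- by exists [::].
move=> r m' rn m9 fr [l [[sl ul ln pl] Kl l7 l5 [lv nd]]].
have n0 : (0 < n)%N by lia.
have [x xn [xE xmin]] := tree_root lv nd n0.
(* A job [y] is left. Its key is below [top], so the root cannot hold an extracted job. *)
have [y [yn yl]] : exists y, (y < n)%N /\ y \notin l.
  have /allPn[y] : ~~ all [in l] (iota 0 n).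
    apply/negP => /allP sub.
    have := uniq_leq_size (iota_uniq 0 n) sub; rewrite size_iota sl; lia.
  by rewrite mem_iota => yn yl; exists y.
have xl : x \notin l.
  apply/negP => xl; have := xmin y yn; rewrite !l5 // xl (negPf yl) leNgt.
  by rewrite /top KC.
have Kx z : z \notin l -> (z < n)%N -> K x <= K z.
  by move=> zl zn; have := xmin z zn; rewrite !l5 // (negPf xl) (negPf zl).
pose m3 := update (update (update m' 11 0 x%:R) 7 r x%:R) 5 x top.
apply: (@runs_seq _ _ _ _ _ _ (eq (update m3 10 0 (n + x)%:R))).
  apply: runs_straight => //.
  rewrite /extract_root run_seq run_assign (@eval_read _ _ _ _ 1) // xE.
  rewrite run_seq (@run_write _ _ _ _ _ r); last by rewrite evalE updateNE.
  rewrite evalE updateE eqxx.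
  rewrite run_seq (@run_write _ _ _ _ _ x); last by rewrite evalE updateNE // updateE.
  rewrite run_assign !evalE eval_cap.
  rewrite !(@updateNE _ _ 5) // !(@updateNE _ _ 7) // updateE eqxx.
  by rewrite !(@updateNE _ _ 11) // !fr // mn natrD.
move=> _ <-; set m4 := update m3 _ _ _.
have m4x : m4 10%N 0%N = (n + x)%:R by rewrite /m4 updateE.
have m46 : m4 6%N = m' 6%N by rewrite /m4 /m3 !updateNE.
have m45 j : m4 5%N j = if j == x then top else m' 5%N j.
  by rewrite /m4 updateNE // /m3 updateE !updateNE.
have lv4 : leaves m4 by move=> j jn; rewrite m46 lv.
have nd4 := node_removed lv xn nd m46.
(* The leaf has a number below [2 * n], which is one level more than for [n]. *)
have logn : (n + x < 2 ^ (trunc_log 2 n).+2)%N.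
  by have := trunc_log_ltn n (isT : 1 < 2)%N; rewrite [in X in _ -> X]expnS; lia.
have := @runs_climb m4 (n + x)%N (trunc_log 2 n).+1 m4x ltac:(lia) logn lv4 _.
move=> H; apply: runs_weaken (runs_frame (H _)) => {H} //; last first.
  apply: nd4 => [j jx|]; first by rewrite m45 (negPf jx).
  by rewrite m45 eqxx l5 // (negPf xl) ltW // KC.
move=> m5 [[lv5 nd5] fr5]; exists (rcons l x); split.
- split.
  + by rewrite size_rcons sl.
  + by rewrite rcons_uniq xl.
  + by move=> z; rewrite mem_rcons inE => /predU1P[->|/ln].
  + by rewrite pairwise_rcons pl andbT; apply/allP => z zl; apply: Kl.
- move=> u v; rewrite !mem_rcons !inE negb_or => /predU1P[->|ul'] /andP[_ vl] vn.
    exact: Kx.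
  exact: Kl.
- move=> i; rewrite fr5 // nth_rcons sl /m4 updateNE // /m3 updateNE // updateE.
  rewrite ltnS leq_eqVlt => /predU1P[->|ir]; first by rewrite eqxx ltnn.
  by rewrite ir ltn_eqF // updateNE // l7.
- move=> j jn; rewrite fr5 // m45 mem_rcons inE l5 //.
  by have [] := eqVneq j x.
- by split.
Qed.

(* When sw is set, the machines are exchanged. *)
Variable sw : bool.
Let ka := if sw then 2%N else 1%N.
Let kb := if sw then 1%N else 2%N.

(** * Johnson keys and head starts *)

Definition init_body :=
  let i := Var 9 in
  Seq (If (Le (Read ka i) (Read kb i)) (Write 5 i (Read ka i))
         (Write 5 i (Sub (Add (Mul (Const 2) cap) (Const 1)) (Read kb i))))
      (Write 6 (Add (Var 0) i) i).

Lemma runs_init m : m 0%N 0%N = n%:R ->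
  runs (For init_body) m (n * 60 + 8) (fun m' =>
    [/\ leaves m', forall j, (j < n)%N ->
        m' 5%N j = johnson_key (m ka) (m kb) (m 0%N 1%N) j &
      forall k, k \notin [:: 5; 6; 9]%N -> m' k = m k]).
Proof.
move=> mn.
pose Inv i m' := forall j, (j < i)%N -> m' 6%N (n + j)%N = j%:R /\
  m' 5%N j = johnson_key (m ka) (m kb) (m 0%N 1%N) j.
have := @runs_for _ init_body n 49 Inv m mn.
move=> H; apply: runs_weaken (H _ _ _ _ _) => {H} //.
- move=> m' [I fr]; split=> [j /I[]//|j /I[]//|k nk].
  by apply: fr; move: nk; rewrite !inE; lia.
- move=> i m' ni m9 fr Ii; apply: runs_straight => //.
  have nE : m' 0%N 0%N = n%:R by rewrite fr.
  have iE m1 : m1 9%N = m' 9%N -> eval m1 (Var 9) = i%:R by rewrite evalE => ->.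
  have aE : eval m' (Read ka (Var 9)) = m ka i.
    by rewrite (eval_read _ (iE _ _)) // fr //; rewrite /ka; case: (sw).
  have bE : eval m' (Read kb (Var 9)) = m kb i.
    by rewrite (eval_read _ (iE _ _)) // fr //; rewrite /kb; case: (sw).
  rewrite /init_body run_seq run_if evalE aE bE !(run_write _ _ (iE _ _)) //.
  rewrite aE !evalE bE eval_cap fr //.
  rewrite -(fun_if (update m' 5 i)) -/(johnson_key (m ka) (m kb) (m 0%N 1%N) i).
  set m1 := update _ _ _ _.
  have i1 : eval m1 (Var 9) = i%:R by apply: iE; rewrite /m1 updateNE.
  rewrite (@run_write _ _ _ _ _ (n + i)%N); last first.
    by rewrite evalE i1 evalE /m1 updateNE // nE natrD.
  move=> j; rewrite ltnS leq_eqVlt => /predU1P[->|ji].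
    by rewrite updateE eqxx i1 updateNE // /m1 updateE eqxx.
  rewrite updateE ifN; last by lia.
  rewrite updateNE // /m1 updateNE // updateE ifN; last by lia.
  exact: Ii.
Qed.

(** One step of the recurrence of [lead]. *)
Definition bump k :=
  let a := Read ka (Var 11) in
  let new := Sub (Var k) (Sub (Read kb (Var 11)) a) in
  If (Le a new) (Assign k new) (Assign k a).

Lemma run_bump m k x : m 11%N 0%N = x%:R ->
  run (bump k) m =
  update m k 0 (Num.max (m ka x) (m k 0%N - (m kb x - m ka x))).
Proof.
move=> mx; have xE : eval m (Var 11) = x%:R by rewrite evalE.
rewrite /bump run_if !evalE !(eval_read _ xE) !run_assign !evalE !(eval_read _ xE).
by case: leP.
Qed.

(** The order is scanned from its end, because [lead] recurs on suffixes. Scalar 14 follows the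
    whole order; scalar 13 follows the first half, and array 8 records its successive values. *)
Definition lead_body :=
  let v := Var 10 in let x := Var 11 in
  Seq (Assign 10 (Sub (Sub (Var 0) (Const 1)) (Var 9)))
 (Seq (Assign 11 (Read 7 v))
 (Seq (If (Le (Read ka x) (Read kb x))
          (Seq (Assign 15 (Add (Var 15) (Const 1))) (bump 13)) Skip)
 (Seq (Write 8 v (Var 13)) (bump 14)))).

Lemma runs_lead m l : m 0%N 0%N = n%:R -> size l = n ->
  (forall i, (i < n)%N -> m 7%N i = (nth 0%N l i)%:R) ->
  m 13%N 0%N = 0 -> m 14%N 0%N = 0 -> m 15%N 0%N = 0 ->
  let J1 x := m ka x <= m kb x in
  runs (For lead_body) m (n * (110 + 11) + 8) (fun m' =>
    [/\ m' 14%N 0%N = lead (m ka) (m kb) l,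
        m' 15%N 0%N = (count J1 l)%:R,
        forall p, (p < n)%N ->
          m' 8%N p = lead (m ka) (m kb) (seq.filter J1 (drop p l)) &
      forall k, k \notin [:: 8; 9; 10; 11; 13; 14; 15]%N -> m' k = m k]).
Proof.
move=> mn sl m7 m13 m14 m15 J1.
pose ld := lead (m ka) (m kb).
pose Inv i m' := let l' := drop (n - i) l in
  [/\ m' 13%N 0%N = ld (seq.filter J1 l'), m' 14%N 0%N = ld l',
      m' 15%N 0%N = (count J1 l')%:R &
      forall p, (n - i <= p < n)%N -> m' 8%N p = ld (seq.filter J1 (drop p l))].
have := @runs_for _ lead_body n 110 Inv m mn.
move=> H; apply: runs_weaken (H _ _ _ _ _) => {H} //.
- move=> m' [[e13 e14 e15 e8] fr]; rewrite subnn drop0 in e13 e14 e15 e8.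
  by split=> // k nk; apply: fr; move: nk; rewrite !inE; lia.
- by rewrite /Inv subn0 -sl drop_size; split=> // p; lia.
- move=> i m' ni m9 fr [e13 e14 e15 e8]; apply: runs_straight => //.
  have [v vE] : exists v, v = (n - i.+1)%N by exists (n - i.+1)%N.
  have [x xE] : exists x, x = nth 0%N l v by exists (nth 0%N l v).
  have dE : drop v l = x :: drop (n - i) l.
    rewrite xE (drop_nth 0%N); last by rewrite sl; lia.
    by congr (_ :: drop _ _); lia.
  rewrite run_seq run_assign !evalE m9 fr // mn.
  rewrite (_ : n%:R - 1%:~R - i%:R = v%:R); last first.
    by rewrite vE natrB // -natr1; ring.
  set m1 := update _ _ _ _.
  have m1v : eval m1 (Var 10) = v%:R by rewrite evalE /m1 updateE.
  have m17 : m1 7%N v = x%:R.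
    by rewrite /m1 updateNE // fr // m7 ?xE //; lia.
  rewrite run_seq run_assign (eval_read _ m1v) m17; set m2 := update m1 _ _ _.
  have ab k : k \in [:: 1; 2]%N -> m2 k = m k.
    rewrite !inE => kab; rewrite /m2 /m1 !updateNE ?fr //; by case/orP: kab => /eqP ->.
  have kaE m3 : m3 1%N = m 1%N -> m3 2%N = m 2%N -> m3 ka = m ka /\ m3 kb = m kb.
    by rewrite /ka /kb; case: (sw).
  have m2x : m2 11%N 0%N = x%:R by rewrite /m2 updateE.
  have m2xE : eval m2 (Var 11) = x%:R by rewrite evalE.
  have [m2a m2b] := kaE m2 (ab 1%N isT) (ab 2%N isT).
  rewrite run_seq run_if evalE !(eval_read _ m2xE) m2a m2b.
  pose m3 := if J1 x then update (update m2 15 0 (count J1 (drop v l))%:R) 13 0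
               (ld (seq.filter J1 (drop v l))) else m2.
  rewrite (_ : (if _ then _ else _) = m3); last first.
    rewrite /m3 -/(J1 x); have [Jx|//] := boolP (J1 x).
    rewrite run_seq run_assign (@run_bump _ _ x); last by rewrite updateNE.
    set m2' := update m2 _ _ _.
    have [-> ->] : m2' ka = m ka /\ m2' kb = m kb.
      by apply: kaE; rewrite /m2' updateNE // ab.
    rewrite /m2' evalE eval_var dE /= Jx /= /m2 /m1 !updateNE // e15 e13.
    by rewrite add1n -natr1.
  have m3k k : k != 15%N -> k != 13%N -> m3 k = m2 k.
    by move=> k15 k13; rewrite /m3; case: ifP; rewrite // !updateNE.
  have m3_13 : m3 13%N 0%N = ld (seq.filter J1 (drop v l)).
    rewrite /m3; have [Jx|nJ] := boolP (J1 x); first by rewrite updateE.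
    by rewrite dE /= (negPf nJ) /m2 /m1 !updateNE.
  have m3_15 : m3 15%N 0%N = (count J1 (drop v l))%:R.
    rewrite /m3; have [Jx|nJ] := boolP (J1 x); first by rewrite updateNE // updateE.
    by rewrite dE /= (negPf nJ) /m2 /m1 !updateNE.
  have m3v : eval m3 (Var 10) = v%:R.
    by rewrite evalE m3k // /m2 updateNE // updateE.
  rewrite run_seq (run_write _ _ m3v) (@run_bump _ _ x); last first.
    by rewrite updateNE // m3k.
  rewrite evalE m3_13; set m4 := update m3 _ _ _.
  have [m4a m4b] : m4 ka = m ka /\ m4 kb = m kb.
    by apply: kaE; rewrite /m4 updateNE // m3k // ab.
  rewrite m4a m4b /m4; split.
  + by rewrite !updateNE // m3_13 vE.
  + rewrite updateE updateNE // m3k // /m2 /m1 !updateNE // e14.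
    by rewrite -vE dE.
  + by rewrite !updateNE // m3_15 vE.
  + move=> p pn; rewrite updateNE // updateE; have [->//|pv] := eqVneq p v.
    by rewrite m3k // /m2 /m1 !updateNE // e8 //; lia.
Qed.

(** * Construction of the schedule *)

Let k1 := if sw then 4%N else 3%N.
Let k2 := if sw then 3%N else 4%N.

Definition quarter_cap := Div cap (Const 4).

(** The test is the side condition of [ahead_step1], its negation that of [ahead_step2]. Both
    positions refer to array 7; scalar 17 starts at the size of the first half. *)
Definition pick :=
  If (And (Lt (Var 16) (Var 15))
        (Not (And (Lt (Var 17) (Var 0)) (Le (Add quarter_cap (Read 8 (Var 16))) (Var 18)))))
    (Seq (Assign 11 (Read 7 (Var 16))) (Assign 16 (Add (Var 16) (Const 1))))
    (Seq (Assign 11 (Read 7 (Var 17))) (Assign 17 (Add (Var 17) (Const 1)))).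

(** The step of [placed_cons]. Truncating [s] first is what makes the first machine wait. *)
Definition place :=
  let x := Var 11 in let s := Var 18 in let t := Var 19 in
  Seq (If (Le s (Mul (Const 2) quarter_cap)) Skip (Assign 18 (Mul (Const 2) quarter_cap)))
 (Seq (Write k1 x (Sub t s))
 (Seq (Write k2 x t)
 (Seq (Assign 19 (Add t (Read kb x)))
      (Assign 18 (Add s (Sub (Read kb x) (Read ka x))))))).

Lemma run_place m x : m 11%N 0%N = x%:R ->
  let s' := Num.min (m 18%N 0%N) (2 * (m 0%N 1%N / 4)) in
  let m' := run place m in
  [/\ m' k1 = (fun j => if j == x then m 19%N 0%N - s' else m k1 j),
      m' k2 = (fun j => if j == x then m 19%N 0%N else m k2 j),
      m' 18%N 0%N = s' + (m kb x - m ka x) &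
      m' 19%N 0%N = m 19%N 0%N + m kb x].
Proof.
move=> mx s' m'; rewrite {}/m'.
pose m1 := if m 18%N 0%N <= 2 * (m 0%N 1%N / 4) then m else update m 18 0 s'.
rewrite /place run_seq run_if !evalE eval_cap run_assign !evalE eval_cap.
rewrite (_ : (if _ then _ else _) = m1); last first.
  by rewrite /m1 /s'; case: leP.
have m1k k : k != 18%N -> m1 k = m k.
  by move=> nk; rewrite /m1; case: ifP => // _; rewrite updateNE.
have m18 : m1 18%N 0%N = s' by rewrite /m1 /s'; case: leP; rewrite ?updateE.
have xE m2 : m2 11%N = m 11%N -> eval m2 (Var 11) = x%:R by rewrite evalE => ->.
rewrite run_seq (run_write _ _ (xE _ _)) ?m1k // !evalE m18 m1k //.
set m2 := update m1 _ _ _.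
have m2_11 : m2 11%N = m 11%N by rewrite /m2 /k1; case: (sw); rewrite updateNE // m1k.
rewrite run_seq (run_write _ _ (xE _ m2_11)) !evalE.
set m3 := update m2 _ _ _.
have k12 : k1 != k2 by rewrite /k1 /k2; case: (sw).
have m3k k : k \notin [:: 3; 4]%N -> m3 k = m1 k.
  rewrite !inE negb_or => /andP[k3 k4].
  by rewrite /m3 /m2 /k1 /k2; case: (sw); rewrite !updateNE.
have kb18 : [/\ ka != 18%N, kb != 18%N, ka \notin [:: 3; 4]%N & kb \notin [:: 3; 4]%N].
  by rewrite /ka /kb; case: (sw).
have [a18 b18 a34 b34] := kb18.
have m3_11 : m3 11%N = m 11%N by rewrite m3k // m1k.
rewrite run_seq [run (Assign 19 _) _]run_assign !evalE.
rewrite (eval_read _ (xE _ m3_11)) !m3k // !m1k //.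
set m4 := update m3 _ _ _.
have m4_11 : m4 11%N = m 11%N by rewrite /m4 updateNE.
have [a19 b19] : ka != 19%N /\ kb != 19%N by rewrite /ka /kb; case: (sw).
rewrite run_assign !evalE !(eval_read _ (xE _ m4_11)) /m4.
rewrite !(@updateNE _ _ _ _ _ ka) // !(@updateNE _ _ _ _ _ kb) // !m3k // !m1k //.
rewrite (@updateNE _ m3 19 _ _ 18) // m3k // m18.
have [k1n k2n] : (k1 != 18)%N && (k1 != 19)%N /\ (k2 != 18)%N && (k2 != 19)%N.
  by rewrite /k1 /k2; case: (sw).
have [[k118 k119] [k218 k219]] := (andP k1n, andP k2n).
split.
- apply/funext => j; rewrite !updateNE // /m3 updateNE // /m2 updateE.
  by rewrite m1k.
- apply/funext => j; rewrite !updateNE // /m3 updateE /m2.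
  have k21 : k2 != k1 by rewrite eq_sym.
  have k119' : 19%N != k1 by rewrite /k1; case: (sw).
  by rewrite !updateNE // !m1k.
- by rewrite updateE.
- by rewrite updateNE // updateE.
Qed.

Lemma run_pick m i j : m 16%N 0%N = i%:R -> m 17%N 0%N = j%:R ->
  run pick m =
  if (i%:R < m 15%N 0%N) &&
     ~~ ((j%:R < m 0%N 0%N) && (m 0%N 1%N / 4 + m 8%N i <= m 18%N 0%N))
  then update (update m 11 0 (m 7%N i)) 16 0 i.+1%:R
  else update (update m 11 0 (m 7%N j)) 17 0 j.+1%:R.
Proof.
move=> mi mj.
have iE : eval m (Var 16) = i%:R by rewrite evalE.
have jE : eval m (Var 17) = j%:R by rewrite evalE.
rewrite /pick run_if !evalE eval_cap (eval_read _ iE) mi mj.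
case: ifP => _; rewrite run_seq run_assign run_assign !evalE.
  by rewrite (eval_read _ iE) updateNE // mi -natr1.
by rewrite (eval_read _ jE) updateNE // mj -natr1.
Qed.

(** In the invariant, [q] lists the placed jobs, latest first, and [i] and [j] are the positions
    reached in the two halves. [ahead] ensures that the next job arrives in time for the second
    machine, and [placed] describes the partial schedule. *)
Lemma runs_merge m L1 L2 : let l := L1 ++ L2 in
  let a := m ka in let b := m kb in let P := m 0%N 1%N / 4 in
  let d := m 18%N 0%N in
  m 0%N 0%N = n%:R -> perm_eq l (iota 0 n) -> 0 <= P -> bounded a b P l ->
  all (fun x => a x <= b x) L1 -> all (fun x => b x < a x) L2 ->
  (forall i, (i < n)%N -> m 7%N i = (nth 0%N l i)%:R) ->
  (forall p, (p < n)%N -> m 8%N p =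
     lead a b [seq x <- drop p l | a x <= b x]) ->
  m 15%N 0%N = (size L1)%:R -> m 16%N 0%N = 0 -> m 17%N 0%N = (size L1)%:R ->
  m 19%N 0%N = d -> d = lead a b l -> d <= P ->
  runs (For (Seq pick place)) m (n * (110 + 11) + 8) (fun m' =>
    (exists q s, perm_eq q (iota 0 n) /\
      placed a b P d q (m' k1) (m' k2) s (m' 19%N 0%N)) /\
    forall k, k \notin 9%N :: writes (Seq pick place) -> m' k = m k).
Proof.
move=> l a b P d mn lP P0 lb L1P L2P m7 m8 m15 m16 m17 m19 dE dP.
have ul : uniq l by rewrite (perm_uniq lP) iota_uniq.
have sl : size l = n by rewrite (perm_size lP) size_iota.
have sL : (size L1 <= n)%N by rewrite -sl size_cat leq_addr.
have [kaN kbN] : ka \notin [:: 3; 4; 9; 11; 16; 17; 18; 19]%N /\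
                 kb \notin [:: 3; 4; 9; 11; 16; 17; 18; 19]%N.
  by rewrite /ka /kb; case: (sw).
have fNE k : k \notin [:: 3; 4; 9; 11; 16; 17; 18; 19]%N ->
    k \notin 9%N :: writes (Seq pick place).
  rewrite /= /k1 /k2 !inE; case: (sw); lia.
have frN (m1 m2 : memory R) :
    (forall k, k \notin 9%N :: writes (Seq pick place) -> m1 k = m2 k) ->
    forall k, k \notin [:: 3; 4; 9; 11; 16; 17; 18; 19]%N -> m1 k = m2 k.
  by move=> h k kN; apply/h/fNE.
have filt p : (p <= size L1)%N -> [seq x <- drop p l | a x <= b x] = drop p L1.
  move=> pL; rewrite (_ : drop p l = drop p L1 ++ L2); last first.
    rewrite /l drop_cat; case: ltnP => // Lp.
    have -> : p = size L1 by apply/eqP; rewrite eqn_leq pL.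
    by rewrite subnn drop0 drop_size.
  rewrite filter_cat (@eq_in_filter _ _ pred0 L2) ?filter_pred0 ?cats0.
    by apply/all_filterP/allP => x /mem_drop; apply: (allP L1P).
  by move=> x /(allP L2P); rewrite ltNge => /negPf.
pose Inv k m' := exists i j q,
  [/\ [/\ k = (i + (j - size L1))%N, (i <= size L1)%N & (size L1 <= j <= n)%N],
      m' 16%N 0%N = i%:R /\ m' 17%N 0%N = j%:R,
      perm_eq (q ++ drop i L1 ++ drop j l) l,
      ahead a b P (drop i L1) (drop j l) (m' 18%N 0%N) &
      placed a b P d q (m' k1) (m' k2) (m' 18%N 0%N) (m' 19%N 0%N)].
have := @runs_for _ (Seq pick place) n 110 Inv m mn.
move=> H; apply: runs_weaken (H _ _ _ _ _) => {H} //.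
- move=> m' [[i [j [q [[nE iL jL] _ oP _ pl]]]] fr]; split; last first.
    by move=> k nk; apply: fr.
  exists q, (m' 18%N 0%N); split=> //; apply: perm_trans lP.
  by move: oP; rewrite !drop_oversize ?sl ?cats0 //; lia.
- by rewrite /= /k1 /k2; case: (sw).
- by rewrite /= /k1 /k2; case: (sw).
- move=> i m' x [i1 [j [q h]]]; exists i1, j, q.
  by move: h; rewrite !updateNE // /k1 /k2; case: (sw).
- exists 0%N, (size L1), [::]; split=> //.
  + by split=> //; rewrite ?subnn ?leqnn.
  + by rewrite drop0 /l drop_size_cat.
  + rewrite drop0 /l drop_size_cat //; split; first by rewrite -/l -dE.
    by move=> _; rewrite -/d; lra.
  + by rewrite m19; exact: placed_nil.
move=> k m' kn m9 fr [i [j [q [[kE iL jL] [m16' m17'] oP ah pl]]]].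
apply: runs_straight => //.
have {}fr := frN _ _ fr.
have aE : m' ka = a by rewrite fr.
have bE : m' kb = b by rewrite fr.
have ob x : x \in q ++ drop i L1 ++ drop j l -> x \in l by rewrite (perm_mem oP).
have uo : uniq (q ++ drop i L1 ++ drop j l) by rewrite (perm_uniq oP).
have place_step x m1 : m1 11%N 0%N = x%:R ->
    (forall k, k != 11%N -> k != 16%N -> k != 17%N -> m1 k = m' k) ->
    x \in l -> x \notin q -> a x <= Num.min (m' 18%N 0%N) (2 * P) ->
    let m2 := run place m1 in
    [/\ placed a b P d (x :: q) (m2 k1) (m2 k2) (m2 18%N 0%N) (m2 19%N 0%N),
       m2 18%N 0%N = Num.min (m' 18%N 0%N) (2 * P) + (b x - a x),
       m2 16%N = m1 16%N & m2 17%N = m1 17%N].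
  move=> m1x m1k lx xo axs m2.
  have [e1 e2 e18 e19] := run_place m1x.
  rewrite -/m2 in e1 e2 e18 e19.
  have m1N k' : k' \notin [:: 11; 16; 17]%N -> m1 k' = m' k'.
    by rewrite !inE !negb_or => /and3P[*]; apply: m1k.
  have [kaN' kbN'] : ka \notin [:: 11; 16; 17]%N /\ kb \notin [:: 11; 16; 17]%N.
    by rewrite /ka /kb; case: (sw).
  have [k1N k2N] : k1 \notin [:: 11; 16; 17]%N /\ k2 \notin [:: 11; 16; 17]%N.
    by rewrite /k1 /k2; case: (sw).
  rewrite !(m1N 18%N) // !(m1N 0%N) // !(m1N ka) // !(m1N kb) //
    aE bE (fr 0%N) // -/P in e1 e2 e18 e19.
  rewrite (m1N k1) // in e1; rewrite (m1N k2) // in e2.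
  rewrite (m1N 19%N) // in e1 e2 e19.
  have [ax0 _ bx0 _] := lb x lx.
  split=> //.
  - have nx z : z \in q -> z != x by move=> zq; apply: contraNneq xo => <-.
    rewrite e18 e19; apply: placed_cons pl xo ax0 bx0 axs _ _ _ _.
    + by move=> z zq; rewrite e1 ifN // nx.
    + by move=> z zq; rewrite e2 ifN // nx.
    + by rewrite e1 eqxx.
    + by rewrite e2 eqxx.
  - by apply: run_frame; rewrite /= /k1 /k2; case: (sw).
  - by apply: run_frame; rewrite /= /k1 /k2; case: (sw).
rewrite run_seq (run_pick m16' m17') (fr 15%N) // (fr 0%N) // (fr 8%N) // (fr 7%N) //.
rewrite m15 mn -/P !ltr_nat.
have [take1|take2] := ifPn.
  have iL1 : (i < size L1)%N by case/andP: take1.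
  have [x xE] : exists x, x = nth 0%N L1 i by exists (nth 0%N L1 i).
  have sufE : drop i L1 = x :: drop i.+1 L1 by rewrite xE -drop_nth.
  have xE' : nth 0%N l i = x by rewrite /l nth_cat iL1.
  have lx : x \in l by apply: ob; rewrite sufE mem_cat mem_head orbT.
  have xo : x \notin q.
    move: uo; rewrite sufE cat_uniq => /and3P[_ /hasPn /(_ x) h _].
    by apply: h; rewrite mem_head.
  have iN : (i < n)%N := leq_trans iL1 sL.
  rewrite (m7 i iN) xE'.
  rewrite sufE in ah oP ob.
  have [|||axs ah'] := @ahead_step1 _ _ _ _ _ P0 _ _ _ _ _ _ ah.
  - by move=> z zl; apply/lb/ob; rewrite mem_cat zl orbT.
  - by rewrite -sufE; apply/allP => z /mem_drop; apply: (allP L1P).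
  - rewrite -sufE; case/andP: take1 => _; rewrite negb_and -leqNgt -ltNge.
    rewrite (m8 i iN) filt //; case/orP => h; last by right.
    by left; rewrite drop_oversize // sl.
  set m1 := update _ _ _ _.
  have [] := place_step x m1 _ _ lx xo axs.
  - by rewrite /m1 updateNE // updateE.
  - by move=> k' n11 n16 _; rewrite /m1 !updateNE.
  set m2 := run place m1 => pl' e18 e16 e17.
  exists i.+1, j, (x :: q); split=> //.
  - by split=> //; clear -kE iL1 jL; lia.
  - by rewrite e16 e17 /m1 updateE updateNE // updateNE.
  - apply: perm_trans oP; rewrite perm_sym.
    by rewrite (perm_catCA q [:: x] (drop i.+1 L1 ++ drop j l)).
  - by rewrite e18.
(* If the second half were exhausted, [k < n] would leave a job of the first half, and the test
   would have chosen it. *)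
have jn : (j < n)%N.
  rewrite ltnNge; apply: contraNN take2 => nj.
  have iL1 : (i < size L1)%N by clear -kE kn iL jL nj; lia.
  by rewrite iL1 ltnNge nj.
have [y yE] : exists y, y = nth 0%N l j by exists (nth 0%N l j).
have sufE : drop j l = y :: drop j.+1 l by rewrite yE -drop_nth // sl.
have ly : y \in l by apply: ob; rewrite sufE !mem_cat mem_head !orbT.
have yo : y \notin q.
  move: uo; rewrite sufE cat_uniq => /and3P[_ /hasPn /(_ y) h _].
  by apply: h; rewrite mem_cat mem_head orbT.
have bay : b y < a y.
  apply: (allP L2P); rewrite yE /l nth_cat ltnNge; have /andP[-> _] /= := jL.
  rewrite mem_nth // -(ltn_add2l (size L1)) subnKC; last by case/andP: jL.
  by rewrite -size_cat -/l sl.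
rewrite m7 // -yE.
rewrite sufE in ah oP ob.
have [||ays ah'] := @ahead_step2 _ _ _ _ _ _ _ _ _ _ bay ah.
- by move=> z zl; apply/lb/ob; rewrite mem_cat zl orbT.
- have [iL1|Li] := ltnP i (size L1); last first.
    by left; rewrite drop_oversize.
  move: take2; rewrite iL1 jn /= negbK (m8 i (leq_trans iL1 sL)).
  by rewrite filt // => h; right.
set m1 := update _ _ _ _.
have [] := place_step y m1 _ _ ly yo ays.
- by rewrite /m1 updateNE // updateE.
- by move=> k' n11 _ n17; rewrite /m1 !updateNE.
set m2 := run place m1 => pl' e18 e16 e17.
exists i, j.+1, (y :: q); split=> //.
- by split=> //; clear -kE iL jL jn; lia.
- by rewrite e16 e17 /m1 updateE updateNE // updateNE.
- apply: perm_trans oP; rewrite perm_sym catA.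
  by rewrite (perm_catCA (q ++ drop i L1) [:: y] (drop j.+1 l)) -catA.
- by rewrite e18.
Qed.

End Sorting.

(** * Asymptotic time bound *)

(** For [n >= 2], each of the three terms [n * trunc_log 2 n], [n] and 1, multiplied by [ln 2], is
    at most [n * ln n]. Taking [K.+1] keeps the constant positive. *)
Lemma nlogn_bigO (R : realType) (K : nat) :
  (fun n : nat => (K * (n * (trunc_log 2 n).+1 + 1))%:R : R) =O_\oo
  (fun n : nat => n%:R * ln n%:R : R).
Proof.
have ln2 : 0 < ln 2 :> R by rewrite ln_gt0 // ltr1n.
apply/eqO_exP; exists (3 * K.+1%:R / ln 2); first by rewrite divr_gt0 ?mulr_gt0.
near=> n.
have n2 : (2 <= n)%N by near: n; exact: nbhs_infty_ge.
have n0 : 0 < n%:R :> R by rewrite ltr0n; lia.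
have logn : (trunc_log 2 n)%:R * ln 2 <= ln n%:R :> R.
  rewrite mulr_natl -lnXn // ler_ln ?posrE ?exprn_gt0 //.
  by rewrite -natrX ler_nat trunc_logP //; lia.
have ln_n : ln 2 <= ln n%:R :> R by rewrite ler_ln ?posrE // ler_nat.
have ln_ge0 : 0 <= ln n%:R :> R by apply: le_trans ln_n; exact: ltW.
rewrite !ger0_norm ?mulr_ge0 ?ler0n //.
rewrite !natrM natrD natrM -[(trunc_log 2 n).+1%:R]natr1.
rewrite -(ler_pM2r ln2) [leRHS]mulrAC divfK ?gt_eqF //.
set L := (trunc_log 2 n)%:R in logn *.
have n1 : 1 <= n%:R :> R by rewrite ler1n; lia.
set X := n%:R * ln n%:R.
have h1 : n%:R * (L * ln 2) <= X by rewrite ler_pM2l.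
have h2 : n%:R * ln 2 <= X by rewrite ler_pM2l.
have h3 : 1 * ln 2 <= n%:R * ln 2 :> R by rewrite ler_pM2r.
rewrite -mulrA [3 * _]mulrC -mulrA.
apply: ler_pM; rewrite ?ler_nat //.
  rewrite mulr_ge0 ?(ltW ln2) // addr_ge0 ?ler01 // mulr_ge0 ?(ltW n0) //.
  by rewrite addr_ge0 ?ler01 // ler0n.
rewrite mulrDl mul1r mulrDr mulr1 mulrDl -mulrA; lra.
Unshelve. all: by end_near.
Qed.

(** * The program for a less loaded first machine *)

Section Algorithm.
Variables (R : realType) (n : nat).

Definition start_merge :=
  Seq (Assign 16 (Const 0))
 (Seq (Assign 17 (Var 15)) (Seq (Assign 18 (Var 14)) (Assign 19 (Var 14)))).

Definition solve_forward sw :=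
  Seq (For (init_body sw)) (Seq (For build_body)
 (Seq (For (Seq extract_root climb)) (Seq (For (lead_body sw))
 (Seq start_merge (For (Seq pick (place sw))))))).

(** By the comparison of the total loads, [lead_le_bound] gives an initial head start of at most
    [P], as the merge requires. Johnson's order [l] is kept in the conclusion for the lower bound,
    while the jobs are processed in the order of [o]. *)
Lemma runs_solve_forward (sw : bool) (m : memory R) :
  let a := m (if sw then 2%N else 1%N) in
  let b := m (if sw then 1%N else 2%N) in
  let C := m 0%N 1%N in
  m 0%N 0%N = n%:R -> 0 <= C -> bounded a b (C / 4) (iota 0 n) ->
  m 13%N 0%N = 0 -> m 14%N 0%N = 0 -> m 15%N 0%N = 0 ->
  \sum_(x <- iota 0 n) a x <= \sum_(x <- iota 0 n) b x ->
  runs (solve_forward sw) m (100 * (n * (trunc_log 2 n).+1 + 1) * 5) (fun m' =>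
    (exists l o s, [/\ perm_eq l (iota 0 n), johnson a b C l,
      perm_eq o (iota 0 n) &
      placed a b (C / 4) (lead a b l) o
        (m' (if sw then 4%N else 3%N)) (m' (if sw then 3%N else 4%N)) s
        (m' 19%N 0%N)]) /\
    forall k, k \in [:: 0; 1; 2]%N -> m' k = m k).
Proof.
move=> a b C mn C0 bd m13 m14 m15 ab.
pose K := johnson_key a b C.
have P0 : 0 <= C / 4 by lra.
have bdC (l : seq nat) : perm_eq l (iota 0 n) ->
    {in l, forall x, [/\ 0 <= a x, a x <= C, 0 <= b x & b x <= C]}.
  by move=> lP x; rewrite (perm_mem lP) => /bd[*]; split=> //; lra.
have KC j : (j < n)%N -> K j < 2 * C + 2.
  move=> jn; have [|? ? ? ?] := bdC _ (perm_refl _) j; first by rewrite mem_iota.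
  by rewrite /K /johnson_key; case: ifP => _; lra.
apply: (@runs_weaken _ _ _ ((n * 60 + 8) + ((n * 60 + 8) +
  ((n * (40 + ((trunc_log 2 n).+1 * 36 + 4) + 11) + 8) +
  ((n * (110 + 11) + 8) + (30 + (n * (110 + 11) + 8))))))%N _ _ _ _ (fun m' H => H)).
  by lia.
rewrite /solve_forward.
apply: runs_seq (runs_init sw mn) _ => m1 [lv1 K1 fr1].
have m1n : m1 0%N 0%N = n%:R by rewrite fr1.
apply: runs_seq (runs_build m1n lv1) _ => m2 [lv2 nd2 fr2].
have m2n : m2 0%N 0%N = n%:R by rewrite fr2.
have m2C : m2 0%N 1%N = C by rewrite fr2 // fr1.
apply: runs_seq (@runs_extract _ _ m2 K m2n _ _ lv2 nd2) _.
- by move=> j jn; rewrite fr2 // K1.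
- by move=> j jn; rewrite m2C KC.
move=> m3 [[l [lP lK m37]] fr3].
have sl : size l = n by rewrite (perm_size lP) size_iota.
have fr03 k : k \notin [:: 5; 6; 7; 9; 10; 11]%N -> m3 k = m k.
  move=> kN'; rewrite fr3 ?fr2 ?fr1 //; apply: contra kN'; rewrite !inE; lia.
have a3 : m3 (if sw then 2 else 1)%N = a by rewrite fr03 //; case: (sw).
have b3 : m3 (if sw then 1 else 2)%N = b by rewrite fr03 //; case: (sw).
apply: runs_seq (@runs_lead _ _ sw m3 l _ sl m37 _ _ _) _; try by rewrite fr03.
move=> m4 [m4_14 m4_15 m4_8 fr4]; rewrite a3 b3 in m4_14 m4_15 m4_8.
have fr04 k : k \notin [:: 5; 6; 7; 8; 9; 10; 11; 13; 14; 15]%N -> m4 k = m k.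
  move=> kN'; rewrite fr4 ?fr03 //; apply: contra kN'; rewrite !inE; lia.
pose m5 := update (update (update (update m4 16 0 0) 17 0 (m4 15%N 0%N)) 18 0
  (m4 14%N 0%N)) 19 0 (m4 14%N 0%N).
apply: (@runs_seq _ _ _ _ _ _ (eq m5)).
  apply: runs_straight => //.
  rewrite /start_merge !run_seq.
  by rewrite run_assign !evalE run_assign run_assign run_assign !evalE !updateNE.
move=> _ <-.
have fr5 k : k \notin [:: 16; 17; 18; 19]%N -> m5 k = m4 k.
  by rewrite !inE !negb_or => /and4P[*]; rewrite /m5 !updateNE.
have fr05 k : k \in [:: 0; 1; 2]%N -> m5 k = m k.
  by rewrite !inE => kN'; rewrite fr5 ?fr04 // !inE; lia.
have a5 : m5 (if sw then 2 else 1)%N = a.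
  by rewrite fr05 //; case: (sw).
have b5 : m5 (if sw then 1 else 2)%N = b.
  by rewrite fr05 //; case: (sw).
pose L1 := [seq x <- l | a x <= b x]; pose L2 := [seq x <- l | b x < a x].
have lE : l = L1 ++ L2 by apply: (@johnson_split _ _ _ _ C) => //; exact: bdC.
have m5_18 : m5 18%N 0%N = lead a b l.
  by rewrite /m5 updateNE // updateE.
have bdl : bounded a b (C / 4) l.
  by move=> x; rewrite (perm_mem lP); exact: bd.
have L1P : all (fun x => a x <= b x) L1 by exact: filter_all.
have L2P : all (fun x => b x < a x) L2 by exact: filter_all.
have := @runs_merge _ n sw m5 L1 L2.
rewrite /= -lE a5 b5 m5_18 (fr05 0%N) // -/C => H.
apply: runs_weaken (leqnn _) _ (H mn lP P0 bdl L1P L2P _ _ _ _ _ _ erefl _) => {H}.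
- move=> m' [[q [s [qP pl]]] fr]; split; first by exists l, q, s.
  move=> k kN'; rewrite fr ?fr05 //.
  by move: kN'; rewrite !inE; case: (sw); lia.
- by move=> i ni; rewrite fr5 // fr4 // m37.
- by move=> p pn; rewrite fr5 // m4_8.
- by rewrite fr5 // m4_15 size_filter.
- by rewrite /m5 3?updateNE // updateE.
- by rewrite /m5 2?updateNE // updateE m4_15 size_filter.
- by rewrite /m5 updateE.
rewrite lE; apply: lead_le_bound => //; rewrite -lE //.
by rewrite !(perm_big _ lP).
Qed.

(** * Comparison of the loads and time reversal *)

Definition diff_body := Assign 12 (Add (Var 12) (Sub (Read 2 (Var 9)) (Read 1 (Var 9)))).

Lemma runs_diff (m : memory R) : m 0%N 0%N = n%:R -> m 12%N 0%N = 0 ->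
  runs (For diff_body) m (n * (20 + 11) + 8) (fun m' =>
    m' 12%N 0%N = \sum_(x <- iota 0 n) (m 2%N x - m 1%N x) /\
    forall k, k \notin [:: 9; 12]%N -> m' k = m k).
Proof.
move=> mn m12.
pose Inv j m' := m' 12%N 0%N = \sum_(x <- iota 0 j) (m 2%N x - m 1%N x).
have := @runs_for _ diff_body n 20 Inv m mn.
move=> H; apply: runs_weaken (H _ _ _ _ _) => {H} //.
- by rewrite /Inv big_nil.
move=> j m' jn m9 fr Ij; apply: runs_straight => //.
have jE : eval m' (Var 9) = j%:R by rewrite evalE.
rewrite /diff_body run_assign !evalE !(eval_read _ jE).
rewrite (fr 2%N) // (fr 1%N) // Ij /Inv updateE eqxx.
by rewrite -[j.+1]addn1 iotaD big_cat big_seq1.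
Qed.

(** Scalar 19 holds the makespan. With exchanged machines, array 4 holds the first-stage starts of
    jobs with lengths in array 2, so reflecting both arrays in place returns each to its own
    machine. *)
Definition reverse_body :=
  let i := Var 9 in
  Seq (Write 4 i (Sub (Sub (Var 19) (Read 4 i)) (Read 2 i)))
      (Write 3 i (Sub (Sub (Var 19) (Read 3 i)) (Read 1 i))).

Lemma runs_reverse (m : memory R) : m 0%N 0%N = n%:R ->
  runs (For reverse_body) m (n * (40 + 11) + 8) (fun m' => forall j, (j < n)%N ->
    m' 3%N j = m 19%N 0%N - m 3%N j - m 1%N j /\
    m' 4%N j = m 19%N 0%N - m 4%N j - m 2%N j).
Proof.
move=> mn.
pose T := m 19%N 0%N.
pose Inv i m' := forall j,
  m' 3%N j = (if (j < i)%N then T - m 3%N j - m 1%N j else m 3%N j) /\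
  m' 4%N j = (if (j < i)%N then T - m 4%N j - m 2%N j else m 4%N j).
have := @runs_for _ reverse_body n 40 Inv m mn.
move=> H; apply: runs_weaken (H _ _ _ _ _) => {H} //.
- by move=> m' [I _] j jn; have := I j; rewrite jn.
move=> i m' ni m9 fr Ii; apply: runs_straight => //.
have iE m1 : m1 9%N = m' 9%N -> eval m1 (Var 9) = i%:R by rewrite evalE => ->.
rewrite /reverse_body run_seq (run_write _ _ (iE m' erefl)) !evalE.
rewrite !(eval_read _ (iE m' erefl)).
set m1 := update _ _ _ _.
have i1 : m1 9%N = m' 9%N by rewrite /m1 updateNE.
rewrite (run_write _ _ (iE _ i1)) !evalE !(eval_read _ (iE _ i1)) /m1.
rewrite !(@updateNE _ m' 4) // (fr 19%N) // (fr 2%N) // (fr 1%N) // -/T => j.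
have [e3 e4] := Ii i; rewrite ltnn in e3 e4.
rewrite updateE updateNE // updateNE // updateE ltnS.
have [->|ji] := eqVneq j i; first by rewrite leqnn e3 e4.
by rewrite leq_eqVlt (negPf ji); exact: Ii.
Qed.

(** * From instances to flow shops on natural numbers *)

(** Chosen to agree with the arrays of [input] by computation. *)
Definition extend (f : 'I_n -> R) (i : nat) : R := oapp f 0 (insub i).

Lemma extend_ord f (j : 'I_n) : extend f j = f j.
Proof. by rewrite /extend valK. Qed.

Lemma in_iota_ord (Q : nat -> Prop) :
  (forall j : 'I_n, Q j) -> {in iota 0 n, forall x, Q x}.
Proof. by move=> Qj x; rewrite mem_iota => xn; exact: (Qj (Ordinal xn)). Qed.

Section Instance.
Variable I : instance R n.
Let a := extend (proc1 I).
Let b := extend (proc2 I).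
Hypothesis cap_ge : 9 / 2 * Num.max (proc1_max I) (proc2_max I) <= capacity I.
Let P := capacity I / 4.

(** The largest processing time is nonnegative and at most 2/9 of the capacity, hence at most a
    quarter of it. *)
Lemma proc_bound :
  [/\ 0 <= capacity I, forall j, proc1 I j <= P & forall j, proc2 I j <= P].
Proof.
have h1 : 0 <= proc1_max I by exact: bigmax_ge_id.
have h2 : proc1_max I <= Num.max (proc1_max I) (proc2_max I) by rewrite le_max lexx.
have h3 : proc2_max I <= Num.max (proc1_max I) (proc2_max I).
  by rewrite le_max lexx orbT.
have h4 j : proc1 I j <= proc1_max I by exact: le_bigmax.
have h5 j : proc2 I j <= proc2_max I by exact: le_bigmax.
move: cap_ge h1 h2 h3; rewrite /P.
set M := Num.max _ _; set p1 := proc1_max I; set p2 := proc2_max I => h h1 h2 h3.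
by split=> [|j|j]; [lra|have := h4 j; rewrite -/p1; lra|have := h5 j; rewrite -/p2; lra].
Qed.

Lemma feasible_flow_shop s : feasible I s ->
  flow_shop (iota 0 n) a b (extend (start1 s)) (extend (start2 s)).
Proof.
move=> [s0 _ d1 d2 st _]; split.
- by apply: in_iota_ord => j; rewrite extend_ord.
- by apply: in_iota_ord => j; rewrite /a !extend_ord; exact: st.
- move=> x y; rewrite !mem_iota => xn yn xy.
  rewrite -[x]/(val (Ordinal (xn : x < n)%N)) -[y]/(val (Ordinal (yn : y < n)%N)).
  by rewrite /a !extend_ord; apply: d1.
- move=> x y; rewrite !mem_iota => xn yn xy.
  rewrite -[x]/(val (Ordinal (xn : x < n)%N)) -[y]/(val (Ordinal (yn : y < n)%N)).
  by rewrite /b !extend_ord; apply: d2.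
Qed.

Lemma flow_shop_feasible (S1 S2 : nat -> R) :
  flow_shop (iota 0 n) a b S1 S2 ->
  {in iota 0 n, forall x, S2 x + b x <= S1 x + 3 * P} ->
  feasible I (Schedule (fun j : 'I_n => S1 j) (fun j : 'I_n => S2 j)).
Proof.
move=> fs flow; have [C0 aP bP] := proc_bound.
have [s0 st d1 d2] := fs.
have jn (j : 'I_n) : (j : nat) \in iota 0 n by rewrite mem_iota ltn_ord.
have aE (j : 'I_n) : a j = proc1 I j by exact: extend_ord.
have bE (j : 'I_n) : b j = proc2 I j by exact: extend_ord.
split=> /=.
- by move=> j; exact: s0.
- by move=> j; apply: le_trans (st j (jn j)); rewrite addr_ge0 ?s0 // aE proc1_ge0.
- by move=> i j ij; rewrite /compl1 /= -!aE; apply: d1.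
- by move=> i j ij; rewrite /compl2 /= -!bE; apply: d2.
- by move=> j; rewrite /compl1 /= -aE; exact: st.
(* The capacity is exactly the bound of [flow_time_storage]. *)
move=> t; rewrite (_ : capacity I = 4 * P); last by rewrite /P; field.
apply: le_trans (@flow_time_storage _ _ _ _ _ S1 S2 P t (iota_uniq 0 n) fs _ _).
- rewrite (_ : iota 0 n = index_iota 0 n) ?big_mkord; last by rewrite /index_iota subn0.
  rewrite /storage /compl2 /=; under eq_bigr do rewrite -aE.
  by under eq_bigl do rewrite -bE.
- apply: in_iota_ord => j; rewrite aE proc1_ge0 aP; split=> //.
  exact: flow.
- by rewrite divr_ge0.
Qed.

Lemma proc_bounded : bounded a b P (iota 0 n) /\ bounded b a P (iota 0 n).
Proof.
have [C0 aP bP] := proc_bound.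
by split; apply: in_iota_ord => j; rewrite /a /b !extend_ord proc1_ge0 proc2_ge0 aP bP.
Qed.

Lemma feasible_compl2 s : feasible I s ->
  {in iota 0 n, forall x, extend (start2 s) x + b x <= makespan I s}.
Proof.
by move=> fs; apply: in_iota_ord => j; rewrite /b !extend_ord; exact: le_bigmax.
Qed.

Lemma optimal_intro (S1 S2 : nat -> R) (T : R) :
  flow_shop (iota 0 n) a b S1 S2 ->
  {in iota 0 n, forall x, S2 x + b x <= S1 x + 3 * P} ->
  {in iota 0 n, forall x, S2 x + b x <= T} -> 0 <= T ->
  (forall s, feasible I s -> T <= makespan I s) ->
  optimal I (Schedule (fun j : 'I_n => S1 j) (fun j : 'I_n => S2 j)).
Proof.
move=> fs flow le_T T0 lower; split; first exact: flow_shop_feasible.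
move=> s /lower; apply: le_trans; apply: bigmax_le => // j _.
rewrite /compl2 /= -(extend_ord (proc2 I)); apply: le_T.
by rewrite mem_iota ltn_ord.
Qed.

End Instance.

Lemma placed_iota (a b S1 S2 : nat -> R) (P d s T : R) (o : seq nat) :
  perm_eq o (iota 0 n) -> placed a b P d o S1 S2 s T ->
  bounded a b P (iota 0 n) ->
  [/\ flow_shop (iota 0 n) a b S1 S2,
      {in iota 0 n, forall x, S2 x + b x <= S1 x + 3 * P},
      {in iota 0 n, forall x, S2 x + b x <= T} &
      T = d + \sum_(x <- iota 0 n) b x].
Proof.
move=> oP [sT TE le_end flow fs] bd.
have oE : o =i iota 0 n := perm_mem oP.
split.
- by apply: sub_flow_shop fs => x; rewrite oE.
(* At most [2 * P] passes between the two starts, and the second operation takes at most [P]. *)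
- move=> x xn; have [_ _ _ bP] := bd x xn.
  by have := flow x; rewrite oE => /(_ xn); lra.
- by move=> x; rewrite -oE => /le_end[].
- by rewrite TE (perm_big _ oP).
Qed.

End Algorithm.

(** * The complete program *)

Definition solve :=
  Seq (For diff_body)
    (If (Le (Const 0) (Var 12)) (solve_forward false)
       (Seq (solve_forward true) (For reverse_body))).

Definition solve_time n := (700 * (n * (trunc_log 2 n).+1 + 1))%N.

(** In both branches the schedule ends exactly at the bound of [johnson_lower_bound]. In the second
    branch this bound is applied to the reversal of the competing schedule, within the same
    makespan. *)
Lemma runs_solve (R : realType) (n : nat) (I : instance R n) :
  9 / 2 * Num.max (proc1_max I) (proc2_max I) <= capacity I ->
  runs solve (input I) (solve_time n) (fun m => optimal I (output n m)).
Proof.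
move=> cap_ge; pose m0 := input I.
pose a := extend (proc1 I); pose b := extend (proc2 I).
have [C0 _ _] := proc_bound cap_ge.
have [bab bba] := proc_bounded cap_ge.
have leC l (x y : nat -> R) : perm_eq l (iota 0 n) ->
    bounded x y (capacity I / 4) (iota 0 n) ->
    {in l, forall j, [/\ 0 <= x j, x j <= capacity I, 0 <= y j & y j <= capacity I]}.
  by move=> lP bd j; rewrite (perm_mem lP) => /bd[*]; split=> //; lra.
apply: (@runs_weaken _ _ _ ((n * (20 + 11) + 8) + (4 +
  (100 * (n * (trunc_log 2 n).+1 + 1) * 5 + (n * (40 + 11) + 8))))%N _ _ _ _ (fun m' H => H)).
  by rewrite /solve_time; lia.
apply: runs_seq (runs_diff (m := m0) _ _) _ => // m1 [m1_12 fr1].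
have m1_0 : m1 0%N = m0 0%N by rewrite fr1.
have m1_1 : m1 1%N = a by rewrite fr1.
have m1_2 : m1 2%N = b by rewrite fr1.
have zero k : k \in [:: 13; 14; 15]%N -> m1 k 0%N = 0.
  by rewrite !inE => kN; rewrite fr1 ?inE; [case/or3P: kN => /eqP ->|lia].
apply: runs_if; rewrite !evalE m1_12 sumrB subr_ge0.
have m0E : m0 0%N 0%N = n%:R /\ m0 0%N 1%N = capacity I by [].
have [m0n m0C] := m0E.
case: leP => [ab|/ltW ba].
  have H := @runs_solve_forward _ n false m1.
  rewrite /= m1_0 m1_1 m1_2 !zero // m0C in H.
  have {}H := H m0n C0 bab erefl erefl erefl ab.
  apply: runs_weaken (leq_addr _ _) _ H => m2 [[l [q [s [lP lJ qP pl]]]] _].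
  rewrite /= in pl.
  have [fs flow le_T TE] := placed_iota qP pl bab.
  have [S10 _ _ _] := fs.
  apply: (optimal_intro cap_ge fs flow le_T).
    rewrite TE addr_ge0 //.
      apply: (lead_ge0 (P := capacity I / 4)) => x.
      by rewrite (perm_mem lP); exact: bab.
    by rewrite big_seq; apply: sumr_ge0 => x /bab[].
  move=> s' fs'; rewrite TE -(perm_big _ lP).
  have sub : {subset l <= iota 0 n} by move=> x; rewrite (perm_mem lP).
  apply: (@johnson_lower_bound _ _ a b (capacity I) l _ _ _ _ _ lJ).
  - exact: leC lP bab.
  - by rewrite (perm_uniq lP) iota_uniq.
  - exact: sub_flow_shop sub (feasible_flow_shop fs').
  - by move=> x /sub; exact: feasible_compl2.
  - exact: bigmax_ge_id.
have H := @runs_solve_forward _ n true m1.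
rewrite /= m1_0 m1_1 m1_2 !zero // m0C in H.
have {}H := H m0n C0 bba erefl erefl erefl ba.
apply: runs_seq H _ => m2 [[l [q [s [lP lJ qP pl]]]] fr2].
rewrite /= in pl.
have [fs flow le_T TE] := placed_iota qP pl bba.
have m2n : m2 0%N 0%N = n%:R by rewrite fr2 // m1_0.
apply: runs_weaken (leqnn _) _ (runs_reverse m2n) => m3 rev.
have outE : output n m3 = Schedule
    (fun j : 'I_n => m2 19%N 0%N - m2 3%N j - a j)
    (fun j : 'I_n => m2 19%N 0%N - m2 4%N j - b j).
  congr Schedule; apply/funext => j; have [e3 e4] := rev j (ltn_ord j).
    by rewrite e3 (fr2 1%N) // m1_1.
  by rewrite e4 (fr2 2%N) // m1_2.
have [S10 _ _ _] := fs.
rewrite outE.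
apply: (@optimal_intro _ _ _ cap_ge (fun x => m2 19%N 0%N - m2 3%N x - a x)
  (fun x => m2 19%N 0%N - m2 4%N x - b x) (m2 19%N 0%N)).
- exact: (@reverse_flow_shop _ _ _ _ _ _ _ _ fs le_T).
- by move=> x xn; have := flow x xn; rewrite -/b; lra.
- by move=> x xn; have := S10 x xn; rewrite -/b; lra.
- rewrite TE addr_ge0 //.
    apply: (lead_ge0 (P := capacity I / 4)) => x.
    by rewrite (perm_mem lP); exact: bba.
  by rewrite big_seq; apply: sumr_ge0 => x /bba[].
move=> s' fs'; rewrite TE -(perm_big _ lP).
have sub : {subset l <= iota 0 n} by move=> x; rewrite (perm_mem lP).
have fs1 := @sub_flow_shop _ _ _ _ _ _ _ _ sub (feasible_flow_shop fs').
have le_M := feasible_compl2 fs'.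
have [S1'0 _ _ _] := fs1.
apply: (@johnson_lower_bound _ _ b a (capacity I) l _ _ _ _ _ lJ).
- exact: leC lP bba.
- by rewrite (perm_uniq lP) iota_uniq.
- by apply: (@reverse_flow_shop _ _ _ _ _ _ _ (makespan I s') fs1) => x /sub /le_M.
- by move=> x /S1'0; rewrite -/a; lra.
- exact: bigmax_ge_id.
Qed.

Theorem corollary1 (R : realType) :
  exists (p : program) (T : nat -> nat),
    (forall (n : nat) (I : instance R n),
       (0 < n)%N ->
       9 / 2 * Num.max (proc1_max I) (proc2_max I) <= capacity I ->
       exists (t : nat) (mem : memory R),
         [/\ exec p (input I) t mem,
             (t <= T n)%N &
             optimal I (output n mem)])
    /\ (fun n : nat => (T n)%:R : R) =O_\oo (fun n : nat => n%:R * ln n%:R : R).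
Proof.
exists solve, solve_time; split; first by move=> n I _; exact: runs_solve.
exact: nlogn_bigO.
Qed.
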